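(* Put $N_d(k)=\binom{d+k-1}{k}+\binom{d+k-2}{k-1}$ and $N'_d(k)=2\binom{d+k-2}{k-1}$. (i) Let $X$ be a locally $k$-distance set on $S^{d-1}$. If $|X|=N_d(k)$, then for some determined weight function $w$, $(X,w)$ is a tight weighted spherical $2k$-design. Conversely, if $(X,w)$ is a tight weighted spherical $2k$-design, then $X$ is a locally $k$-distance set (indeed, $X$ is a $k$-distance set). (ii) Let $X$ be an antipodal locally $k$-distance set on $S^{d-1}$. If $|X|=N'_d(k)$, then for some determined weight function $w$, $(X,w)$ is a tight weighted spherical $(2k-1)$-design. Conversely, if $(X,w)$ is a tight weighted spherical $(2k-1)$-design, then $X$ is an antipodal locally $k$-distance set (indeed, $X$ is an antipodal $k$-distance set).
   Context: Here $d$ and $k$ are positive integers, $S^{d-1}$ is the unit sphere in $\mathbb{R}^d$, and $d(x,y)$ is the Euclidean distance. For $X\subset\mathbb{R}^d$ let $A(X)=\{d(x,y): x,y\in X,\ x\ne y\}$ and, for $x\in X$, $A_X(x)=\{d(x,y): y\in X,\ y\neq x\}$. $X$ is a $k$-distance set if $|A(X)|=k$, and a locally $k$-distance set if $|A_X(x)|\le k$ for all $x\in X$. $X$ is antipodal if $-x\in X$ for every $x\in X$. A weight function on a finite set $X\subset S^{d-1}$ is a function $w:X\to\mathbb{R}_{>0}$ with $\sum_{x\in X}w(x)=1$. The pair $(X,w)$ is a weighted spherical $t$-design if $\frac{1}{|S^{d-1}|}\int_{S^{d-1}}f(x)\,d\sigma(x)=\sum_{x\in X}w(x)f(x)$ for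 every polynomial $f$ in $d$ variables of degree at most $t$, where $\sigma$ is the surface measure and $|S^{d-1}|$ its total mass. Every weighted spherical $2e$-design satisfies $|X|\ge N_d(e)$ and every weighted spherical $(2e-1)$-design satisfies $|X|\ge N'_d(e)$; the design is called tight if equality holds in the corresponding bound.
   Formalization: The claims ''indeed, X is a k-distance set'' in (i) and (ii) are stated only for d ≥ 2 or k = 1, since for d = 1 and k ≥ 2 the set {1,-1} with weights 1/2 is a tight design with only one distance. *)

(* Defs.v *)
From HB Require Import structures.
From mathcomp Require Import all_boot all_order all_algebra.
From mathcomp Require Import finmap.
From mathcomp Require Import all_classical all_reals all_analysis.
(* The notations of mpoly clash with those of analysis. *)
From mathcomp Require mpoly.
Import -(notations) mpoly.

Set Implicit Arguments.
Unset Strict Implicit.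
Unset Printing Implicit Defensive.

Import Order.TTheory GRing.Theory Num.Theory.
Import numFieldNormedType.Exports.

Local Open Scope fset_scope.
Local Open Scope ring_scope.

(* The norm carried by 'rV[R]_d in analysis is the sup norm, hence a separate
   Euclidean norm. *)
Definition eucl_norm (R : realType) (d : nat) (x : 'rV[R]_d) : R :=
  Num.sqrt (\sum_(i < d) x ord0 i ^+ 2).

Definition eucl_dist (R : realType) (d : nat) (x y : 'rV[R]_d) : R := eucl_norm (x - y).

Definition on_sphere (R : realType) (d : nat) (X : {fset 'rV[R]_d}) : Prop :=
  forall x, x \in X -> eucl_norm x = 1.

Definition distances (R : realType) (d : nat) (X : {fset 'rV[R]_d}) : {fset R} :=
  [fset eucl_dist p.1 p.2 | p in [fset q in X `*` X | q.1 != q.2]].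

Definition distances_from (R : realType) (d : nat) (X : {fset 'rV[R]_d})
    (x : 'rV[R]_d) : {fset R} :=
  [fset eucl_dist x y | y in X `\ x].

Definition distance_set (R : realType) (d k : nat) (X : {fset 'rV[R]_d}) : Prop :=
  #|` distances X| = k.

Definition locally_distance_set (R : realType) (d k : nat)
    (X : {fset 'rV[R]_d}) : Prop :=
  forall x, x \in X -> (#|` distances_from X x| <= k)%N.

Definition antipodal (R : realType) (d : nat) (X : {fset 'rV[R]_d}) : Prop :=
  forall x, x \in X -> - x \in X.

(* Integral of f over S^{d-1} in R^d against the surface measure, computed in
   spherical coordinates.  On S^0 = {1, -1} the surface measure is the counting
   measure.  For d = m + 2, S^{d-1} is parametrized by (theta, u) in
   [0, pi] x S^{d-2} through x = (cos theta, sin theta * u), and the surface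
   element is (sin theta)^(d-2) dtheta dsigma(u).  The value for d = 0 is a
   dummy. *)
Fixpoint sphere_integral (R : realType) (d : nat) : ('rV[R]_d -> R) -> R :=
  match d return ('rV[R]_d -> R) -> R with
  | 0 => fun=> 0
  | d'.+1 =>
    match d' return (('rV[R]_d' -> R) -> R) -> ('rV[R]_d'.+1 -> R) -> R with
    | 0 => fun _ f => f (const_mx 1) + f (const_mx (- 1))
    | m.+1 => fun I f =>
        \int[@lebesgue_measure R]_(theta in `[0, pi]%classic)
          (sin theta ^+ m *
           I (fun u : 'rV[R]_m.+1 => f (row_mx (cos theta)%:M (sin theta *: u))))
    end (@sphere_integral R d')
  end.

Definition sphere_area (R : realType) (d : nat) : R :=
  sphere_integral (fun _ : 'rV[R]_d => 1).

Definition weight_function (R : realType) (d : nat) (X : {fset 'rV[R]_d})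
    (w : X -> R) : Prop :=
  (forall x, 0 < w x) /\ \sum_(x : X) w x = 1.

(* msize is one more than the total degree. *)
Definition weighted_design (R : realType) (d t : nat) (X : {fset 'rV[R]_d})
    (w : X -> R) : Prop :=
  [/\ on_sphere X,
      weight_function w &
      forall f : mpoly d R,
        (msize f <= t.+1)%N ->
        (sphere_area R d)^-1 *
          sphere_integral (fun x : 'rV[R]_d => meval (x ord0) f)
        = \sum_(x : X) w x * meval (val x ord0) f].

(* The truncated subtractions are genuine for d, e >= 1. *)
Definition tight_size_even (d e : nat) : nat :=
  ('C(d + e - 1, e) + 'C(d + e - 2, e - 1))%N.

Definition tight_size_odd (d e : nat) : nat :=
  (2 * 'C(d + e - 2, e - 1))%N.

Definition tight_even_design (R : realType) (d e : nat) (X : {fset 'rV[R]_d})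
    (w : X -> R) : Prop :=
  weighted_design (2 * e) w /\ #|` X| = tight_size_even d e.

Definition tight_odd_design (R : realType) (d e : nat) (X : {fset 'rV[R]_d})
    (w : X -> R) : Prop :=
  weighted_design (2 * e - 1) w /\ #|` X| = tight_size_odd d e.

(* Main.v *)
From HB Require Import structures.
Require Import Defs.
From mathcomp Require Import all_boot all_order all_algebra finmap.
From mathcomp Require Import ring lra zify.
From mathcomp Require mpoly.

Set Implicit Arguments.
Unset Strict Implicit.
Unset Printing Implicit Defensive.

(** Write I for the normalised integral over the unit sphere, Pol_k for the
    functions on the sphere given by polynomials of degree at most k, and x.y
    for the dot product.  In dimension d >= 2 everything rests on one family of
    relations between the moments of I, [mean_mulX]: for f homogeneous of degree
    n, (n + d - 1) I(X_i f) is I of the partial derivative of f along X_i.  In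
    spherical coordinates these relations come from the Wallis recurrences.

    From distances to designs.  As |x - y|^2 = 2 - 2 x.y, in a locally k-distance
    set every point x has a polynomial p_x of degree at most k with p_x(1) = 1
    and p_x(x.y) = 0 for the other points y.  The functions p_x(x.-) are dual to
    the evaluations at X, so that when |X| = dim Pol_k they form a basis and
    g = sum_x g(x) p_x(x.-) on the sphere for all g in Pol_k.  Multiply by a
    harmonic polynomial psi of degree k and integrate: by the Funk-Hecke formula
    [funk_hecke], I(p_x(x.-) psi) = w_x psi(x), where w_x is a positive constant
    times the coefficient of degree k of p_x.  Hence
    I(g psi) = sum_x w_x g(x) psi(x).  The harmonics Re and Im of
    (a.X + i b.X)^k, with a and b orthonormal, are enough to reach all degrees up
    to 2k: their products with Pol_k give the powers of the linear form a.X of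
    degree 2k and 2k - 1 ([ideal_pow]), these powers span the homogeneous
    polynomials ([power_span]), and multiplying by |X|^2 = 1 takes care of the
    lower degrees ([design_of_top_degrees]).  The weights are positive because
    p_x has degree exactly k: otherwise p_x(t) (t - 1) would still be in the
    range of the interpolation formula, vanish on X, and hence be zero.  They are
    unique because exactness for p_x(x.-) reads w_x = I(p_x(x.-)).  An antipodal
    set is treated in the same way, with one point of each antipodal pair, the
    homogeneous polynomials of degree k - 1 instead of Pol_k, and polynomials p_x
    with the parity of k - 1; odd degrees are then exact by symmetry.

    From designs to distances.  For every n there is a polynomial G_n in one
    variable whose zonal functions reproduce the homogeneous polynomials of
    degree n, I(G_n(x.-) g) = g(x), and G_n(1) is the dimension of that space
    ([exists_zonal_kernel]).  Put Q = G_k + G_(k-1), so Q(1) = |X| for a tight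
    2k-design.  Exactness for Q(x.-)^2 gives sum_y w_y Q(x.y)^2 = Q(1), whence
    w_x <= 1/|X|; since the weights add up to one, all of these are equalities and
    Q(x.y) = 0 for all y other than x ([tight_weights]).  So there are at most k
    distances.  For a tight (2k - 1)-design the same argument applied to
    (1 + t) G_(k-1)(t)^2 shows that every y other than x is -x or satisfies
    G_(k-1)(x.y) = 0, and the mean of G_(k-1)(x.-)^2 would be too small if -x were
    missing.  There cannot be fewer than k distances when d >= 2: some
    polynomial of admissible degree, nonnegative on [-1, 1], would vanish at all
    x.y, hence on the whole sphere ([design_nonneg_eq0]).

    In dimension one the sphere is a pair of points, and everything is checked
    directly. *)

Module SpherePolynomials.
Import mpoly.
Import Order.TTheory GRing.Theory Num.Theory.
Local Open Scope ring_scope.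

(** * Dot products and polynomial functions *)

Section Dot.
Variables (R : rcfType) (d : nat).
Implicit Types (x y z : 'rV[R]_d) (c : R).

Definition dot x y : R := \sum_i x ord0 i * y ord0 i.

Definition onS x : Prop := dot x x = 1.

Lemma dotC x y : dot x y = dot y x.
Proof. by apply: eq_bigr => i _; rewrite mulrC. Qed.

Lemma dotDl x y z : dot (x + y) z = dot x z + dot y z.
Proof. by rewrite /dot -big_split; apply: eq_bigr => i _; rewrite mxE mulrDl. Qed.

Lemma dotZl c x y : dot (c *: x) y = c * dot x y.
Proof. by rewrite /dot mulr_sumr; apply: eq_bigr => i _; rewrite mxE mulrA. Qed.

Lemma dotDr x y z : dot z (x + y) = dot z x + dot z y.
Proof. by rewrite dotC dotDl !(dotC _ z). Qed.

Lemma dotZr c x y : dot y (c *: x) = c * dot y x.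
Proof. by rewrite dotC dotZl dotC. Qed.

Lemma dotNl x y : dot (- x) y = - dot x y.
Proof. by rewrite -scaleN1r dotZl mulN1r. Qed.

Lemma dotNr x y : dot x (- y) = - dot x y.
Proof. by rewrite dotC dotNl dotC. Qed.

Definition dotE := (dotDl, dotDr, dotZl, dotZr, dotNl, dotNr).

Lemma dot_ge0 x : 0 <= dot x x.
Proof. by apply: sumr_ge0 => i _; rewrite -expr2 sqr_ge0. Qed.

Lemma dot_eq0 x : (dot x x == 0) = (x == 0).
Proof.
apply/eqP/eqP => [|->]; last by rewrite /dot big1 // => i _; rewrite mxE mul0r.
move=> /eqP; rewrite psumr_eq0 => [/allP x0|i _]; last by rewrite -expr2 sqr_ge0.
apply/rowP => i; rewrite mxE; apply/eqP.
by have := x0 i (mem_index_enum _); rewrite -expr2 sqrf_eq0.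
Qed.

Lemma dot_delta x i : dot (delta_mx ord0 i) x = x ord0 i.
Proof.
rewrite /dot (bigD1 i) //= big1 => [|j /negPf ji]; rewrite mxE ?eqxx ?mul1r ?addr0 //=.
by rewrite ji mul0r.
Qed.

Lemma unit_multiple x : x != 0 -> exists2 c, c != 0 & exists2 u, onS u & x = c *: u.
Proof.
move=> x0; have nx : 0 < dot x x by rewrite lt_neqAle dot_ge0 eq_sym dot_eq0 x0.
have s0 : Num.sqrt (dot x x) != 0 by rewrite gt_eqF // sqrtr_gt0.
exists (Num.sqrt (dot x x)) => //; exists ((Num.sqrt (dot x x))^-1 *: x).
  rewrite /onS !dotE mulrA -expr2 exprVn sqr_sqrtr ?dot_ge0 //.
  by rewrite mulVf // gt_eqF.
by rewrite scalerA divff // scale1r.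
Qed.

End Dot.

(** Subtracting from each standard basis vector its component along x cannot
    always give zero, because x does not span a space of dimension two or more. *)
Lemma exists_orthonormal (R : rcfType) p (x : 'rV[R]_p.+2) :
  onS x -> exists2 b, onS b & dot x b = 0.
Proof.
move=> xS.
have [i /eqP xi] : exists i : 'I_p.+2, delta_mx ord0 i - x ord0 i *: x != 0.
  apply/existsP; rewrite -negb_forall; apply/negP => /forallP h.
  have e (i : 'I_p.+2) : delta_mx ord0 i = x ord0 i *: x.
    by apply/eqP; rewrite -subr_eq0.
  have := dot_delta (delta_mx ord0 ord0 : 'rV[R]_p.+2) ord_max.
  have := dot_delta (delta_mx ord0 ord0 : 'rV[R]_p.+2) ord0.
  have := dot_delta (delta_mx ord0 ord_max : 'rV[R]_p.+2) ord_max.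
  rewrite !e !dotE xS !mulr1 -!e !mxE !eqxx /= => h1 h2 h3.
  by move: (congr1 (fun t => t * t) h3); rewrite mulr0 mulrACA h1 h2 => /eqP;
    rewrite mulr1 oner_eq0.
have /unit_multiple[c c0 [b bS bE]] := introN eqP xi; exists b => //.
apply: (mulfI c0); rewrite mulr0 -dotZr -bE !dotE xS mulr1.
by rewrite dotC dot_delta subrr.
Qed.

(** A second dimension is essential: on the two-point sphere of dimension one,
    only the values 1 and -1 occur. *)
Lemma exists_dot (R : rcfType) p (x : 'rV[R]_p.+2) t :
  onS x -> -1 <= t <= 1 -> exists2 y, onS y & dot x y = t.
Proof.
move=> xS /andP[t1 t2]; have [b bS xb] := exists_orthonormal xS.
exists (t *: x + Num.sqrt (1 - t ^+ 2) *: b); last first.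
  by rewrite !dotE xb xS mulr1 mulr0 addr0.
rewrite /onS !dotE xS bS (dotC b x) xb !(mulr1, mulr0, addr0, add0r) -!expr2.
by rewrite sqr_sqrtr ?[t ^+ 2 + _]addrC ?subrK //; nra.
Qed.

Lemma poly_eq0_on_itv (R : rcfType) (q : {poly R}) :
  (forall t, -1 <= t <= 1 -> q.[t] = 0) -> q = 0.
Proof.
move=> q0; apply/eqP; case: eqP => // /eqP qN0.
(* Any size q distinct points of the interval would do. *)
pose s := [seq (i.+1%:R)^-1 : R | i <- iota 0 (size q)].
have /max_poly_roots := qN0; move=> /(_ s); rewrite size_map size_iota ltnn.
move=> h; suff : false by []; apply: h.
  apply/allP => _ /mapP[i _ ->]; apply/eqP/q0; rewrite invf_le1 ?ltr0n // ler1n andbT.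
  by apply: (@le_trans _ _ 0); rewrite ?lerN10 // invr_ge0 ler0n.
rewrite map_inj_uniq ?iota_uniq // => i j /invr_inj /eqP.
by rewrite eqr_nat eqSS => /eqP.
Qed.

Lemma zonal_eq0 (R : rcfType) p (x : 'rV[R]_p.+2) (q : {poly R}) : onS x ->
  (forall y, onS y -> q.[dot x y] = 0) -> q = 0.
Proof.
by move=> xS q0; apply: poly_eq0_on_itv => t /(exists_dot xS)[y yS <-]; exact: q0.
Qed.

(** Uniqueness of the expansion in base B. *)
Lemma digits_inj B n (e e' : 'I_n -> nat) :
  (forall i, e i < B)%N -> (forall i, e' i < B)%N ->
  (\sum_i e i * B ^ i = \sum_i e' i * B ^ i)%N -> e =1 e'.
Proof.
elim: n e e' => [|n IHn] e e' eB e'B; first by move=> _ [].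
have B0 : (0 < B)%N by apply: leq_ltn_trans (eB ord0).
have recl (f : 'I_n.+1 -> nat) :
    (\sum_i f i * B ^ i = (\sum_(i < n) f (lift ord0 i) * B ^ i) * B + f ord0)%N.
  rewrite big_ord_recl muln1 addnC; congr (_ + _)%N; rewrite big_distrl /=.
  by apply: eq_bigr => i _; rewrite expnSr mulnA.
rewrite !recl => E i.
have e0 : e ord0 = e' ord0.
  by move/(congr1 (modn^~ B)): E; rewrite !modnMDl !modn_small.
move: E; rewrite e0 => /addIn /eqP; rewrite eqn_pmul2r // => /eqP /IHn E.
by case: (unliftP ord0 i) => [j|] -> //; apply: E => k.
Qed.

(** Kronecker substitution: replacing X_i by t^(B^i), with B larger than all the
    exponents, sends distinct monomials to distinct powers of t. *)
Lemma mpoly_fun_eq0 (R : rcfType) n (f : {mpoly R[n]}) :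
  (forall v, f.@[v] = 0) -> f = 0.
Proof.
move=> f0; pose B := msize f; pose K (m : 'X_{1..n}) := (\sum_i m i * B ^ i)%N.
have KB m : m \in msupp f -> forall i, (m i < B)%N.
  move=> mf i; apply: leq_ltn_trans (msize_mdeg_lt mf).
  by rewrite mdegE (bigD1 i) //= leq_addr.
pose q : {poly R} := \sum_(m <- msupp f) f@_m *: 'X^(K m).
have q0 : q = 0.
  apply: poly_eq0_on_itv => t _; rewrite -[RHS](f0 (fun i => t ^+ (B ^ i)%N)) mevalE.
  rewrite horner_sum; apply: eq_bigr => m _; rewrite hornerZ hornerXn; congr (_ * _).
  by rewrite -prodrXr; apply: eq_bigr => i _; rewrite -exprM mulnC.
apply/mpolyP => m; rewrite mcoeff0; have [mf|/memN_msupp_eq0//] := boolP (m \in msupp f).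
have := congr1 (fun r : {poly R} => r`_(K m)) q0.
rewrite coef0 coef_sum (bigD1_seq m) ?msupp_uniq //= coefZ coefXn eqxx mulr1.
rewrite big_seq_cond big1 ?addr0 // => m' /andP[m'f m'm].
rewrite coefZ coefXn; case: eqP => [E|]; last by rewrite mulr0.
by case/eqP: m'm; apply/mnmP => i; symmetry; move: i; apply: digits_inj E; exact: KB.
Qed.

(** * Means over the sphere and their moment relations *)

(** The properties of the normalised surface integral that the combinatorial
    argument uses. The first three determine all the moments; [mean_ext] and
    [mean_ge0_eq0] say that it is an integral over the whole sphere. *)
Record sphere_mean (R : rcfType) d (J : {scalar {mpoly R[d]}}) : Prop := SphereMean {
  mean1 : J 1 = 1;
  mean_U1 : forall (m : 'X_{1..d}) i, m i = 1%N -> J 'X_[m] = 0;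
  mean_U2 : forall (m : 'X_{1..d}) i,
    (mdeg m + d)%:R * J 'X_[m + U_(i) *+ 2] = (m i).+1%:R * J 'X_[m];
  mean_ext : forall f g, (forall x, onS x -> f.@[x ord0] = g.@[x ord0]) -> J f = J g;
  mean_ge0_eq0 : forall f, (forall x, onS x -> 0 <= f.@[x ord0]) -> J f = 0 ->
    forall x, onS x -> f.@[x ord0] = 0
}.

Lemma mean_sqr_eq0 (R : rcfType) d (J : {scalar {mpoly R[d]}}) : sphere_mean J ->
  forall f, J (f ^+ 2) = 0 -> forall x, onS x -> f.@[x ord0] = 0.
Proof.
move=> HJ f Jf x xS; apply/eqP; rewrite -sqrf_eq0 -rmorphXn /=; apply/eqP.
by apply: (mean_ge0_eq0 HJ) Jf x xS => y _; rewrite rmorphXn /= sqr_ge0.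
Qed.

Lemma mnm_split1 d (m : 'X_{1..d}) i : (0 < m i)%N -> m = (U_(i) + (m - U_(i)))%MM.
Proof.
by move=> mi; apply/mnmP => j; rewrite mnmDE mnmBE mnm1E; case: eqP => [<-|_]; lia.
Qed.

Lemma mdeg_succ d n (m : 'X_{1..d}) : mdeg m = n.+1 ->
  exists i m', m = (U_(i) + m')%MM /\ mdeg m' = n.
Proof.
move=> mn; case: (pickP (fun i => 0 < m i)%N) => [i /mnm_split1 mE|m0].
  exists i, (m - U_(i))%MM; split=> //.
  by move: mn; rewrite {1}mE mdegD mdeg1 => -[].
suff : mdeg m = 0%N by rewrite mn.
by rewrite mdegE big1 // => i _; apply/eqP; rewrite -leqn0 leqNgt m0.
Qed.

Section LinearForms.
Variables (R : rcfType) (d : nat).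
Implicit Types (x y z : 'rV[R]_d) (f g : {mpoly R[d]}) (h : {poly R}).

Definition lin x : {mpoly R[d]} := \sum_i x ord0 i *: 'X_i.

(** Derivative in the direction x. *)
Definition dder x f : {mpoly R[d]} := \sum_i x ord0 i *: mderiv i f.

Lemma lin_ev x y : (lin x).@[y ord0] = dot x y.
Proof.
by rewrite /lin raddf_sum; apply: eq_bigr => i _ /=; rewrite mevalZ mevalXU.
Qed.

Lemma lin_homog x : lin x \is 1.-homog.
Proof. by apply: rpred_sum => i _; rewrite rpredZ // dhomogX; apply/eqP; exact: mdeg1. Qed.

Lemma lin_comb (b c : R) x y : lin (b *: x + c *: y) = b *: lin x + c *: lin y.
Proof.
rewrite /lin !scaler_sumr -big_split; apply: eq_bigr => i _ /=.
by rewrite !mxE scalerDl !scalerA.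
Qed.

Lemma linZ (c : R) x : lin (c *: x) = c *: lin x.
Proof. by rewrite -[c *: x]addr0 -(scale0r x) lin_comb scale0r addr0. Qed.

Lemma lin_delta i : lin (delta_mx ord0 i) = 'X_i.
Proof.
rewrite /lin (bigD1 i) //= big1 => [|j /negPf ji]; rewrite mxE ?eqxx ?scale1r ?addr0 //=.
by rewrite ji scale0r.
Qed.

Lemma dderM x f g : dder x (f * g) = dder x f * g + f * dder x g.
Proof.
rewrite /dder mulr_suml mulr_sumr -big_split; apply: eq_bigr => i _ /=.
by rewrite mderivM scalerDr scalerAl scalerAr.
Qed.

Lemma dderD x f g : dder x (f + g) = dder x f + dder x g.
Proof.
by rewrite /dder -big_split; apply: eq_bigr => i _; rewrite mderivD scalerDr.
Qed.

Lemma dderN x f : dder x (- f) = - dder x f.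
Proof.
by rewrite /dder -sumrN; apply: eq_bigr => i _; rewrite mderivN scalerN.
Qed.

Lemma dder1 x : dder x 1 = 0.
Proof.
by rewrite /dder big1 // => i _; rewrite (mderivC i 1) scaler0.
Qed.

Lemma dder0 x : dder x 0 = 0.
Proof. by rewrite /dder big1 // => i _; rewrite mderiv0 scaler0. Qed.

Lemma dder_lin x y : dder x (lin y) = (dot x y)%:MP.
Proof.
rewrite /dder /dot raddf_sum; apply: eq_bigr => i _ /=.
rewrite /lin (linear_sum (mderiv i)) (bigD1 i) //= big1 => [|j ji].
  rewrite mderivZ mderivX mnm1E eqxx scale1r addr0.
  have -> : (U_(i) - U_(i) = 0)%MM by apply/mnmP => j; rewrite mnmBE mnm0E subnn.
  by rewrite mpolyX0 scalerA alg_mpolyC.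
by rewrite mderivZ mderivX mnm1E (negPf ji) scale0r scaler0.
Qed.

Lemma dderXn x f n : dder x (f ^+ n) = n%:R *: (f ^+ n.-1 * dder x f).
Proof.
elim: n => [|n IHn]; first by rewrite expr0 dder1 scale0r.
rewrite exprS dderM IHn; case: n {IHn} => [|n] /=.
  by rewrite !expr0 scale0r mulr0 addr0 scale1r mulr1 mul1r.
rewrite -!mul_mpolyC -[in RHS]natr1 rmorphD /= mpolyC1 exprS; ring.
Qed.

End LinearForms.

Section Mean.
Variables (R : rcfType) (p : nat).
Local Notation d := p.+2.
Variable (J : {scalar {mpoly R[d]}}).
Hypothesis HJ : sphere_mean J.
Implicit Types (x y z : 'rV[R]_d) (f g : {mpoly R[d]}) (h : {poly R}).

(** Integration by parts for the Gaussian weight, written on the sphere; on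
    monomials it is [mean_U1] when X_i is absent from f and [mean_U2] otherwise. *)
Lemma mean_mulX n f i : f \is n.-homog ->
  (n + p.+1)%:R * J ('X_i * f) = J (mderiv i f).
Proof.
move=> /dhomogP fn; rewrite [f]mpolyE.
rewrite (linear_sum (mderiv i)) mulr_sumr !(linear_sum J) mulr_sumr /=.
rewrite big_seq [RHS]big_seq; apply: eq_bigr => m mf.
rewrite -scalerAr mderivZ !linearZ /= mulrCA; congr (_ * _).
rewrite -mpolyXD mderivX linearZ /=.
have [mi|mi] := posnP (m i).
  by rewrite mi mul0r (mean_U1 HJ (i := i)) ?mulr0 // mnmDE mnm1E eqxx mi.
pose m' := (m - U_(i))%MM; have mE : m = (U_(i) + m')%MM := mnm_split1 mi.
have m'i : m i = (m' i).+1 by rewrite mE mnmDE mnm1E eqxx.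
have nE : (n + p.+1 = mdeg m' + d)%N.
  by have <- : mdeg m = n := fn m mf; rewrite mE mdegD mdeg1; lia.
have -> : (U_(i) + m = m' + U_(i) *+ 2)%MM.
  apply/mnmP => j; rewrite mE !(mnmDE, mnm1E, mulmnE); lia.
by rewrite -/m' m'i nE (mean_U2 HJ).
Qed.

Lemma mean_lin n x f : f \is n.-homog ->
  (n + p.+1)%:R * J (lin x * f) = J (dder x f).
Proof.
move=> fn; rewrite /lin /dder mulr_suml !(linear_sum J) mulr_sumr /=.
by apply: eq_bigr => i _; rewrite -scalerAl !linearZ /= -(mean_mulX i fn) mulrCA.
Qed.

Lemma mean_odd n f : odd n -> f \is n.-homog -> J f = 0.
Proof.
elim/ltn_ind: n f => n IHn f n_odd /dhomogP fn.
rewrite [f]mpolyE (linear_sum J) big_seq big1 // => m mf /=; rewrite linearZ /=.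
suff -> : J 'X_[m] = 0 by rewrite mulr0.
have {f mf fn} : mdeg m = n := fn m mf.
case: n n_odd IHn => // n n_odd IHn /mdeg_succ[i [m' [-> m'n]]].
have m'h : 'X_[m'] \is [in R[d], n.-homog] by rewrite dhomogX; apply/eqP.
have := mean_mulX i m'h; rewrite -mpolyXD mderivX linearZ /=.
have -> : (m' i)%:R * J 'X_[m' - U_(i)] = 0.
  have [->|/mnm_split1 m'E] := posnP (m' i); first by rewrite mul0r.
  have nE : n = (mdeg (m' - U_(i))).+1 by rewrite -m'n {1}m'E mdegD mdeg1.
  rewrite (IHn (mdeg (m' - U_(i)))) ?mulr0 //; first by rewrite nE.
    by move: n_odd; rewrite nE /= negbK.
  by rewrite dhomogX.
by move/eqP; rewrite mulf_eq0 pnatr_eq0 addnS /= => /eqP.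
Qed.

End Mean.

(** * Powers of linear forms and planar harmonics *)

Section PowerSpan.
Variables (R : rcfType) (d : nat).
Implicit Types (x y z : 'rV[R]_d) (f g : {mpoly R[d]}) (E : {mpoly R[d]} -> R).

Lemma linform0 E : scalar E -> E 0 = 0.
Proof. by move=> linE; have := linE (-1) 0 0; rewrite scaler0 addr0 mulN1r addNr. Qed.

Lemma linformZ E : scalar E -> forall c f, E (c *: f) = c * E f.
Proof. by move=> linE c f; have := linE c f 0; rewrite linform0 // !addr0. Qed.

Lemma linformD E : scalar E -> forall f g, E (f + g) = E f + E g.
Proof. by move=> linE f g; have := linE 1 f g; rewrite scale1r mul1r. Qed.

Lemma linform_sum E : scalar E -> forall (I : Type) (r : seq I) P (F : I -> {mpoly R[d]}),
  E (\sum_(i <- r | P i) F i) = \sum_(i <- r | P i) E (F i).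
Proof.
by move=> linE I r P F; apply: (big_morph E (linformD linE) (linform0 linE)).
Qed.

(** Freezing a factor of the argument is what makes the induction of
    [power_span] go through. *)
Lemma linform_mul E g : scalar E -> scalar (fun f => E (g * f)).
Proof. by move=> linE c f f'; rewrite mulrDr -scalerAr linE. Qed.

Lemma linform_homog E n : scalar E -> (forall m, mdeg m = n -> E 'X_[m] = 0) ->
  forall f, f \is n.-homog -> E f = 0.
Proof.
move=> linE E0 f /dhomogP fn; rewrite [f]mpolyE linform_sum // big_seq big1 // => m mf.
by rewrite linformZ // E0 ?mulr0 //; exact: fn.
Qed.

(** Polarisation, stated through the linear forms that vanish on the powers:
    E((z + t e_i)^(n+1)) is a polynomial in t which is identically zero, and its
    coefficient of degree one is a multiple of E(X_i z^n), so induction applies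
    to E(X_i -). *)
Theorem power_span n E : scalar E -> (forall z, E (lin z ^+ n) = 0) ->
  forall f, f \is n.-homog -> E f = 0.
Proof.
elim: n E => [|n IHn] E linE Ez; apply: linform_homog => // m mn.
  have -> : m = 0%MM by apply/eqP; rewrite -mdeg_eq0 mn.
  by rewrite mpolyX0 -(expr0 (lin 0)).
have [i [m' [-> m'n]]] := mdeg_succ mn.
rewrite mpolyXD; apply: (IHn _ (linform_mul 'X_i linE)) => [z|]; last first.
  by rewrite dhomogX; apply/eqP.
pose q : {poly R} := \sum_(j < n.+2) ('C(n.+1, j)%:R * E (lin z ^+ (n.+1 - j) * 'X_i ^+ j)) *: 'X^j.
have q0 : q = 0.
  apply: poly_eq0_on_itv => t _; rewrite -[RHS](Ez (1 *: z + t *: delta_mx ord0 i)).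
  rewrite lin_comb scale1r lin_delta exprDn linform_sum // horner_sum.
  apply: eq_bigr => j _; rewrite hornerZ hornerXn -scaler_nat linformZ // exprZn.
  by rewrite -scalerAr linformZ // mulrA [RHS]mulrAC [RHS]mulrC -!mulrA [RHS]mulrC -!mulrA.
have := congr1 (fun r : {poly R} => r`_1) q0.
rewrite coef0 coef_sum (bigD1 (inord 1)) //= coefZ coefXn inordK // eqxx mulr1.
rewrite big1 => [|j j1]; last first.
  rewrite coefZ coefXn; case: eqP => [E1|]; last by rewrite mulr0.
  by case/eqP: j1; apply/val_inj; rewrite /= inordK // E1.
rewrite addr0 bin1 subn1 expr1 mulrC [X in E X]mulrC => /eqP.
by rewrite mulf_eq0 pnatr_eq0 orbF => /eqP.
Qed.

End PowerSpan.

Section Harmonics.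
Variables (R : rcfType) (d : nat) (a b : 'rV[R]_d).
Implicit Types (x : 'rV[R]_d) (f g : {mpoly R[d]}).
Local Notation u := (lin a).
Local Notation v := (lin b).

(** The real and imaginary parts of (u + i v)^n, where u and v are the linear
    forms of a and b. For orthonormal a and b they are harmonic. *)
Fixpoint cs n : {mpoly R[d]} * {mpoly R[d]} :=
  if n is n'.+1 then
    (u * (cs n').1 - v * (cs n').2, v * (cs n').1 + u * (cs n').2)
  else (1, 0).

Local Notation c n := (cs n).1.
Local Notation s n := (cs n).2.
Local Notation q := (u ^+ 2 + v ^+ 2).

Lemma cs_homog n : (c n \is n.-homog) /\ (s n \is n.-homog).
Proof.
elim: n => [|n [cn sn]] /=; first by rewrite dhomog1 dhomog0.
have uh := lin_homog a; have vh := lin_homog b.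
split; first by rewrite rpredB // -[n.+1]add1n; apply: dhomogM.
by rewrite rpredD // -[n.+1]add1n; apply: dhomogM.
Qed.

(** The addition formulas, from (u + i v)^(i+k) = (u + i v)^i (u + i v)^k. *)
Lemma cs_addn i k :
  c (i + k) = c i * c k - s i * s k /\ s (i + k) = s i * c k + c i * s k.
Proof.
elim: i => [|i [IHc IHs]] /=; first by split; ring.
by rewrite IHc IHs; split; ring.
Qed.

Lemma cs_norm k : c k ^+ 2 + s k ^+ 2 = q ^+ k.
Proof.
elim: k => [|k IHk] /=; first by rewrite !expr0 expr1n expr0n addr0.
by rewrite [RHS]exprS -IHk; ring.
Qed.

(** The real part of z^(i+k) times the conjugate of z^k, where z = u + i v. *)
Lemma cs_lower i k : c k * c (i + k) + s k * s (i + k) = q ^+ k * c i.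
Proof. by have [-> ->] := cs_addn i k; rewrite -cs_norm; ring. Qed.

Lemma cs_double i : u * c i.+1 *+ 2 = c i.+2 + q * c i.
Proof. by rewrite /=; ring. Qed.

(** With z = u + i v, the power u^(n+m) is a combination of monomials in z and
    its conjugate of total degree n + m >= 2n - 1, and one of the two exponents
    of such a monomial is at least n; so u^(n+m) lies in the ideal generated by
    Re z^n and Im z^n. The induction on l expands the factors u one by one; q^j
    c_i stands for the real part of z^(i+j) times the j-th power of the
    conjugate. *)
Theorem ideal_pow (E : {mpoly R[d]} -> R) n m : scalar E -> (n <= m.+1)%N ->
  (forall g, g \is m.-homog -> E (g * c n) = 0 /\ E (g * s n) = 0) ->
  E (u ^+ (n + m)) = 0.
Proof.
move=> linE nm E0.
have qh : q \is 2.-homog by rewrite rpredD //; exact: (dhomogMn 2 (lin_homog _)).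
have qch j i k : (2 * j + i = k)%N -> (q ^+ j * c i \is k.-homog) /\ (q ^+ j * s i \is k.-homog).
  by move=> <-; have [ci si] := cs_homog i; split; apply: dhomogM => //; apply: dhomogMn.
have EB f g : E (f - g) = E f - E g.
  by rewrite linformD // -scaleN1r linformZ // mulN1r.
suff H l i j : (i + 2 * j + l = n + m)%N -> E (u ^+ l * (q ^+ j * c i)) = 0.
  by have := H (n + m)%N 0%N 0%N erefl; rewrite expr0 !mulr1.
elim: l i j => [|l IHl] i j ijl.
  rewrite expr0 mul1r; have [ni|ni] := leqP n i.
    have [gc gs] : (q ^+ j * c (i - n) \is m.-homog) /\ (q ^+ j * s (i - n) \is m.-homog).
      by apply: qch; lia.
    have -> : q ^+ j * c i = q ^+ j * c (i - n) * c n - q ^+ j * s (i - n) * s n.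
      by have [+ _] := cs_addn (i - n) n; rewrite subnK // => ->; ring.
    by rewrite EB (E0 _ gc).1 (E0 _ gs).2 subr0.
  (* Since 2 j = n + m - i >= 2 n - 1 - i, where the left side is even, j >=
     n - i. *)
  pose k := (n - i)%N; have kj : (k <= j)%N by rewrite /k; lia.
  have [gc gs] : (q ^+ (j - k) * c k \is m.-homog) /\ (q ^+ (j - k) * s k \is m.-homog).
    by apply: qch; rewrite /k; lia.
  have -> : q ^+ j * c i = q ^+ (j - k) * c k * c n + q ^+ (j - k) * s k * s n.
    have := cs_lower i k; rewrite /k subnKC ?(ltnW ni) // -/k => e.
    by rewrite -(subnK kj) exprD -mulrA -e addnK; ring.
  by rewrite linformD // (E0 _ gc).1 (E0 _ gs).2 addr0.
case: i ijl => [|i] ijl.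
  have -> : u ^+ l.+1 * (q ^+ j * c 0) = u ^+ l * (q ^+ j * c 1).
    by rewrite /= exprS; ring.
  by apply: IHl; lia.
have : (u ^+ l.+1 * (q ^+ j * c i.+1)) *+ 2 =
    u ^+ l * (q ^+ j * c i.+2) + u ^+ l * (q ^+ j.+1 * c i).
  have -> : c i.+2 = u * c i.+1 *+ 2 - q * c i by rewrite cs_double addrK.
  by rewrite !exprS; ring.
rewrite -scaler_nat => /(congr1 E); rewrite linformZ // linformD // !IHl ?addr0; try lia.
by move=> /eqP; rewrite mulf_eq0 pnatr_eq0 => /eqP.
Qed.

End Harmonics.

(** * Zonal polynomials and the Funk-Hecke formula *)

Definition zon (R : rcfType) d (h : {poly R}) (x : 'rV[R]_d) : {mpoly R[d]} :=
  horner_alg (lin x) h.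

Section Zonal.
Variables (R : rcfType) (d : nat).
Implicit Types (x y z : 'rV[R]_d) (h : {poly R}).

Lemma zonXn n x : zon 'X^n x = lin x ^+ n.
Proof. by rewrite /zon rmorphXn /= horner_algX. Qed.

Lemma zonB h h' x : zon (h - h') x = zon h x - zon h' x.
Proof. exact: rmorphB. Qed.

Lemma zonM h h' x : zon (h * h') x = zon h x * zon h' x.
Proof. exact: rmorphM. Qed.

Lemma zonZ c h x : zon (c *: h) x = c *: zon h x.
Proof. by rewrite /zon linearZ /= mulr_algl. Qed.

Lemma zon_sum (I : Type) (r : seq I) P (F : I -> {poly R}) x :
  zon (\sum_(i <- r | P i) F i) x = \sum_(i <- r | P i) zon (F i) x.
Proof. exact: rmorph_sum. Qed.

Lemma zonE h x : zon h x = \sum_(i < size h) h`_i *: lin x ^+ i.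
Proof.
rewrite -{1}[h]coefK poly_def zon_sum.
by apply: eq_bigr => i _; rewrite zonZ zonXn.
Qed.

Lemma zon_ev h x y : (zon h x).@[y ord0] = h.[dot x y].
Proof.
rewrite zonE raddf_sum horner_coef; apply: eq_bigr => i _ /=.
by rewrite mevalZ rmorphXn /= lin_ev.
Qed.

End Zonal.

Lemma quadrature_error_scalar (R : rcfType) d (J : {scalar {mpoly R[d]}}) (I : finType)
    (w : I -> R) (pt : I -> 'rV[R]_d) :
  scalar (fun f => J f - \sum_i w i * f.@[pt i ord0]).
Proof.
move=> c f g; rewrite linearP /= mulrBr mulr_sumr addrACA -opprD -big_split /=.
congr (_ - _); apply: eq_bigr => i _.
by rewrite mevalD mevalZ mulrDr mulrCA.
Qed.

Section ZonalMean.
Variables (R : rcfType) (p : nat).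
Local Notation d := p.+2.
Variable (J : {scalar {mpoly R[d]}}).
Hypothesis HJ : sphere_mean J.
Implicit Types (x y z : 'rV[R]_d) (f g : {mpoly R[d]}) (h : {poly R}).

(** [mean_lin] applied to one of the factors x.X of the product. *)
Lemma mean_linXM n j x f : f \is n.-homog ->
  (n + j + p.+1)%:R * J (lin x ^+ j.+1 * f) =
  j%:R * dot x x * J (lin x ^+ j.-1 * f) + J (lin x ^+ j * dder x f).
Proof.
move=> fn; rewrite exprS -mulrA (_ : n + j = 1 * j + n)%N; last by lia.
rewrite (mean_lin HJ) ?dhomogM //; last exact/dhomogMn/lin_homog.
rewrite dderM dderXn dder_lin linearD; congr (_ + _).
have -> : j%:R *: (lin x ^+ j.-1 * (dot x x)%:MP) * f =
    (j%:R * dot x x) *: (lin x ^+ j.-1 * f).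
  by rewrite -!mul_mpolyC rmorphM /=; ring.
by rewrite linearZ.
Qed.

Section HarmonicMean.
Variables a b : 'rV[R]_d.
Hypotheses (aS : onS a) (bS : onS b) (ab : dot a b = 0).
Local Notation c n := (cs a b n).1.
Local Notation s n := (cs a b n).2.

(** d(z^(n+1)) = (n+1) z^n dz, split into real and imaginary parts. *)
Lemma dder_cs x n :
  dder x (c n.+1) = n.+1%:R *: (dot x a *: c n - dot x b *: s n) /\
  dder x (s n.+1) = n.+1%:R *: (dot x b *: c n + dot x a *: s n).
Proof.
elim: n => [|n [IHc IHs]].
  rewrite /= !mulr0 !mulr1 subr0 addr0 !dder_lin !scale1r !scaler0 subr0 addr0.
  by rewrite !alg_mpolyC.
have cS k : c k.+1 = lin a * c k - lin b * s k by [].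
have sS k : s k.+1 = lin b * c k + lin a * s k by [].
have nE : n.+2%:R = 1 + n.+1%:R :> R by rewrite -natr1 addrC.
split.
  rewrite cS dderD dderN (dderM x _ (c n.+1)) (dderM x _ (s n.+1)) IHc IHs !dder_lin.
  by rewrite nE -!mul_mpolyC rmorphD /= mpolyC1; ring.
rewrite sS dderD (dderM x _ (c n.+1)) (dderM x _ (s n.+1)) IHc IHs !dder_lin.
by rewrite nE -!mul_mpolyC rmorphD /= mpolyC1; ring.
Qed.

(** A harmonic polynomial of positive degree has mean zero: by [mean_lin] the
    means of the two terms of its recursive definition cancel. *)
Lemma mean_cs0 n : (0 < n)%N -> J (c n) = 0 /\ J (s n) = 0.
Proof.
case: n => // n _; have [cn sn] := cs_homog a b n.
have np : (n + p.+1)%:R != 0 :> R by rewrite pnatr_eq0 addnS.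
have E f g : (n + p.+1)%:R * J (f + g) =
  (n + p.+1)%:R * J f + (n + p.+1)%:R * J g by rewrite linearD mulrDr.
split; apply: (mulfI np); rewrite mulr0 /= E ?linearN ?mulrN !(mean_lin HJ) //.
  case: n {cn sn np E} => [|n]; first by rewrite dder1 dder0 subrr.
  have [-> _] := dder_cs a n; have [_ ->] := dder_cs b n.
  by rewrite aS bS (dotC b a) ab !scale0r !scale1r subr0 addr0 subrr.
case: n {cn sn np E} => [|n]; first by rewrite dder1 dder0 linear0 addr0.
have [_ ->] := dder_cs a n; have [-> _] := dder_cs b n.
rewrite aS bS (dotC b a) ab !scale0r !scale1r sub0r add0r.
by rewrite scalerN linearN addNr.
Qed.

(** Orthogonality of harmonics of degree n to polynomials of lower degree, by
    induction on j: both terms of [mean_linXM] are of the same kind with smaller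
    j. *)
Lemma mean_lin_cs_low x j n : (j < n)%N ->
  J (lin x ^+ j * c n) = 0 /\ J (lin x ^+ j * s n) = 0.
Proof.
elim/ltn_ind: j n => j IHj n jn; case: j jn IHj => [|j] jn IHj.
  by rewrite expr0 !mul1r; apply: mean_cs0.
case: n jn => // n; rewrite ltnS => jn.
have [cn sn] := cs_homog a b n.+1.
have np : (n.+1 + j + p.+1)%:R != 0 :> R by rewrite pnatr_eq0 addnS.
have low f : f = c n.+1 \/ f = s n.+1 -> j%:R * dot x x * J (lin x ^+ j.-1 * f) = 0.
  case: (posnP j) => [->|j0]; first by rewrite !mul0r.
  have [Jc Js] : J (lin x ^+ j.-1 * c n.+1) = 0 /\ J (lin x ^+ j.-1 * s n.+1) = 0.
    by apply: IHj; lia.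
  by case=> ->; rewrite ?Jc ?Js mulr0.
have [Jc Js] := IHj j (ltnSn j) n jn; have [Dc Ds] := dder_cs x n.
split; apply: (mulfI np); rewrite mulr0 mean_linXM // low ?add0r; try by [left|right].
  by rewrite Dc -scalerAr linearZ mulrBr -!scalerAr linearB !linearZ /= Jc Js !mulr0 subrr mulr0.
by rewrite Ds -scalerAr linearZ mulrDr -!scalerAr linearD !linearZ /= Jc Js !mulr0 addr0 mulr0.
Qed.

End HarmonicMean.

(** The Funk-Hecke eigenvalue of t^n on harmonics of degree n in p.+2 variables. *)
Fixpoint funk n : R :=
  if n is n'.+1 then n'.+1%:R / (n'.+1 + n' + p.+1)%:R * funk n' else 1.

Lemma funk_gt0 n : 0 < funk n.
Proof.
by elim: n => [|n IHn] /=; rewrite ?ltr01 // mulr_gt0 // divr_gt0 // ltr0n // addnS.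
Qed.

(** In [mean_linXM] the first term vanishes by [mean_lin_cs_low], and the second
    reproduces the recursive definition of the harmonics at the point x. *)
Lemma mean_lin_cs_top a b x n : onS a -> onS b -> dot a b = 0 ->
  J (lin x ^+ n * (cs a b n).1) = funk n * (cs a b n).1.@[x ord0] /\
  J (lin x ^+ n * (cs a b n).2) = funk n * (cs a b n).2.@[x ord0].
Proof.
move=> aS bS ab; elim: n => [|n [IHc IHs]].
  by rewrite /= !mulr1 expr0 mulr0 meval0 meval1 mulr0 mul1r (mean1 HJ) linear0.
have [cn sn] := cs_homog a b n.+1; have [Dc Ds] := dder_cs a b x n.
have np : (n.+1 + n + p.+1)%:R != 0 :> R by rewrite pnatr_eq0 addnS.
have np' : 1 + n%:R + n%:R + (1 + p%:R) != 0 :> R by rewrite !nat1r -!natrD.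
have [Jc Js] : n%:R * J (lin x ^+ n.-1 * (cs a b n.+1).1) = 0 /\
  n%:R * J (lin x ^+ n.-1 * (cs a b n.+1).2) = 0.
  case: (posnP n) => [->|n0]; first by rewrite !mul0r.
  have [-> ->] : J (lin x ^+ n.-1 * (cs a b n.+1).1) = 0 /\
    J (lin x ^+ n.-1 * (cs a b n.+1).2) = 0 by apply: mean_lin_cs_low => //; lia.
  by rewrite !mulr0.
split; apply: (mulfI np); rewrite mean_linXM // mulrAC ?Jc ?Js mul0r add0r ?Dc ?Ds.
  rewrite -scalerAr linearZ (mulrBr (lin x ^+ n)) -!scalerAr linearB !linearZ /= IHc IHs.
  by rewrite mevalB !mevalM !lin_ev (dotC x a) (dotC x b); field.
rewrite -scalerAr linearZ (mulrDr (lin x ^+ n)) -!scalerAr linearD !linearZ /= IHc IHs.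
by rewrite mevalD !mevalM !lin_ev (dotC x a) (dotC x b); field.
Qed.

(** Only the coefficient of degree n of h survives against a harmonic of degree
    n. *)
Theorem funk_hecke a b x n h : onS a -> onS b -> dot a b = 0 -> (size h <= n.+1)%N ->
  J (zon h x * (cs a b n).1) = funk n * h`_n * (cs a b n).1.@[x ord0] /\
  J (zon h x * (cs a b n).2) = funk n * h`_n * (cs a b n).2.@[x ord0].
Proof.
move=> aS bS ab hn; have [Tc Ts] := mean_lin_cs_top x n aS bS ab.
have -> : zon h x = \sum_(i < n.+1) h`_i *: lin x ^+ i.
  rewrite zonE (big_ord_widen _ (fun i => h`_i *: lin x ^+ i) hn) big_mkcond.
  by apply: eq_bigr => i _; case: ltnP => // hi; rewrite nth_default ?scale0r.
rewrite big_ord_recr /= !mulrDl !mulr_suml !linearD !linear_sum /=.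
rewrite !big1 ?add0r => [|i _|i _]; rewrite -!scalerAl !linearZ /=.
- by rewrite Tc Ts; split; ring.
- by have [_ ->] := mean_lin_cs_low aS bS ab x (ltn_ord i); rewrite mulr0.
- by have [-> _] := mean_lin_cs_low aS bS ab x (ltn_ord i); rewrite mulr0.
Qed.

(** Integrating the interpolation formula against the harmonics of degree n
    gives exactness for their products with homogeneous polynomials of degree m,
    by [funk_hecke]; [ideal_pow] and [power_span] extend it to all of degree n +
    m. *)
Theorem quadrature_of_interpolation (I : finType) (pt : I -> 'rV[R]_d)
    (h : I -> {poly R}) n m :
  (n <= m.+1)%N -> (forall i, (size (h i) <= n.+1)%N) ->
  (forall g y, g \is m.-homog -> onS y ->
    g.@[y ord0] = \sum_i g.@[pt i ord0] * (h i).[dot (pt i) y]) ->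
  forall f, f \is (n + m).-homog ->
    J f = \sum_i funk n * (h i)`_n * f.@[pt i ord0].
Proof.
move=> nm hn interp f fnm; apply/eqP; rewrite -subr_eq0; apply/eqP.
pose E g := J g - \sum_i funk n * (h i)`_n * g.@[pt i ord0].
have linE : scalar E := quadrature_error_scalar J (fun i => funk n * (h i)`_n) pt.
rewrite -/(E f); move: f fnm.
have E0 a b g : onS a -> onS b -> dot a b = 0 -> g \is m.-homog ->
    E (g * (cs a b n).1) = 0 /\ E (g * (cs a b n).2) = 0.
  move=> aS bS ab gm; rewrite /E.
  have ext f : J (g * f) = J (\sum_i g.@[pt i ord0] *: (zon (h i) (pt i) * f)).
    apply: (mean_ext HJ) => y yS; rewrite mevalM (interp g y gm yS) raddf_sum mulr_suml.
    by apply: eq_bigr => i _ /=; rewrite mevalZ mevalM zon_ev mulrA.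
  rewrite !ext !linear_sum -!sumrB.
  split; apply: big1 => i _; have [Fc Fs] := funk_hecke (pt i) aS bS ab (hn i);
    by rewrite linearZ /= ?Fc ?Fs mevalM; ring.
apply: (power_span linE) => z.
have [c [u uS ->]] : exists c, exists2 u, onS u & z = c *: u.
  have [->|/unit_multiple[c _ [u uS ->]]] := eqVneq z 0; last by exists c, u.
  exists 0, (delta_mx ord0 ord0); last by rewrite scale0r.
  by rewrite /onS dot_delta mxE !eqxx.
have [b bS ub] := exists_orthonormal uS.
rewrite linZ exprZn (linformZ linE) (ideal_pow linE nm (b := b)) ?mulr0 // => g.
exact: E0.
Qed.

End ZonalMean.

(** * Gram matrices and monomial bases *)

Section FiniteInverse.
Variable R : fieldType.

Lemma sum_enum_val (I : finType) n (e : #|I| = n) (F : I -> R) :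
  \sum_i F i = \sum_(k < n) F (enum_val (cast_ord (esym e) k)).
Proof.
case: n / e; rewrite (reindex (@enum_val I I)) /=; last by apply/onW_bij/enum_val_bij.
by apply: eq_bigr => k _; rewrite cast_ord_id.
Qed.

(** For square matrices a one-sided inverse is two-sided. *)
Lemma left_inverse_right (I J : finType) (A : I -> J -> R) (B : J -> I -> R) :
  #|I| = #|J| ->
  (forall i i', \sum_j A i j * B j i' = (i == i')%:R) ->
  forall j j', \sum_i B j i * A i j' = (j == j')%:R.
Proof.
move=> IJ AB j j'.
pose eI (k : 'I_#|J|) : I := enum_val (cast_ord (esym IJ) k).
pose eJ (k : 'I_#|J|) : J := enum_val k.
pose MA := \matrix_(i < #|J|, j < #|J|) A (eI i) (eJ j).
pose MB := \matrix_(i < #|J|, j < #|J|) B (eJ i) (eI j).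
have inj_eI : injective eI by move=> k l /enum_val_inj/cast_ord_inj.
have /mulmx1C MBA : MA *m MB = 1%:M.
  apply/matrixP => k l; rewrite !mxE -(inj_eq inj_eI) -AB (sum_enum_val (erefl #|J|)).
  by apply: eq_bigr => m _; rewrite !mxE cast_ord_id.
move/matrixP: MBA => /(_ (enum_rank j) (enum_rank j')).
rewrite !mxE (inj_eq enum_rank_inj) (sum_enum_val IJ) => <-.
by apply: eq_bigr => m _; rewrite !mxE /eJ !enum_rankK.
Qed.

Lemma exists_left_inverse (I : finType) (A : I -> I -> R) :
  (forall v, (forall l, \sum_i v i * A i l = 0) -> forall i, v i = 0) ->
  exists C : I -> I -> R, forall i l, \sum_j C i j * A j l = (i == l)%:R.
Proof.
move=> A_free; pose M := \matrix_(i < #|I|, j < #|I|) A (enum_val i) (enum_val j).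
have M_unit : M \in unitmx.
  rewrite -row_free_unit -kermx_eq0; apply/rowV0P => v /sub_kermxP vM.
  suff h i : v ord0 (enum_rank i) = 0.
    by apply/rowP => k; rewrite mxE -(enum_valK k) h.
  apply: (A_free (fun i => v ord0 (enum_rank i))) => l.
  move/rowP: vM => /(_ (enum_rank l)); rewrite !mxE => vl0.
  rewrite -[RHS]vl0 (sum_enum_val (erefl #|I|)); apply: eq_bigr => k _.
  by rewrite !mxE cast_ord_id enum_valK enum_rankK.
exists (fun i j => invmx M (enum_rank i) (enum_rank j)) => i l.
have /matrixP/(_ (enum_rank i) (enum_rank l)) := mulVmx M_unit.
rewrite !mxE (inj_eq enum_rank_inj) => <-.
rewrite (sum_enum_val (erefl #|I|)); apply: eq_bigr => k _.
by rewrite !mxE cast_ord_id enum_valK enum_rankK.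
Qed.

End FiniteInverse.

Section Monomials.
Variables (R : rcfType) (p : nat).
Local Notation d := p.+1.
Implicit Types (x y z : 'rV[R]_d) (f g : {mpoly R[d]}).

Definition monomials n : seq 'X_{1..d} :=
  [seq s2m (val t) | t : n.-tuple 'I_d <- enum (basis d n)].

(** The exponents of degree n as a finite type, to serve as row indices. *)
Definition monomial_index n : finType := seq_sub (monomials n).

Lemma card_monomial_index n : #|monomial_index n| = 'C(p + n, n).
Proof. by rewrite card_seq_sub ?uniq_basis // size_basis addnC. Qed.

Lemma mdeg_monomial n (m : monomial_index n) : mdeg (val m) = n.
Proof. by apply/eqP; rewrite basis_cover; exact: valP. Qed.

Definition mon n (m : monomial_index n) : {mpoly R[d]} := 'X_[val m].

Lemma mon_homog n (m : monomial_index n) : mon m \is n.-homog.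
Proof. by rewrite dhomogX; apply/eqP; exact: mdeg_monomial. Qed.

Lemma homog_mon n f : f \is n.-homog ->
  f = \sum_(m : monomial_index n) f@_(val m) *: mon m.
Proof.
move=> fn; apply/mpolyP => m; rewrite raddf_sum /=.
have [mn|mn] := eqVneq (mdeg m) n; last first.
  rewrite (dhomog_nemf_coeff fn) ?big1 // => k _.
  rewrite mcoeffZ mcoeffX; case: eqP => [e|]; last by rewrite mulr0.
  by move: mn; rewrite -e mdeg_monomial eqxx.
have mb : m \in monomials n by rewrite -basis_cover mn.
rewrite (bigD1 (SeqSub mb)) //= big1 => [|k km].
  by rewrite mcoeffZ mcoeffX eqxx mulr1 addr0.
rewrite mcoeffZ mcoeffX; case: eqP => [e|]; last by rewrite mulr0.
by case/eqP: km; apply/val_inj.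
Qed.

Lemma homog_evZ n f c x : f \is n.-homog -> f.@[(c *: x) ord0] = c ^+ n * f.@[x ord0].
Proof.
move=> /dhomogP fn; rewrite !mevalE mulr_sumr big_seq [RHS]big_seq.
apply: eq_bigr => m /fn mn; rewrite mulrCA; congr (_ * _).
have {mn} <- : mdeg m = n := mn.
by rewrite mdegE -prodrXr -big_split; apply: eq_bigr => i _; rewrite mxE exprMn.
Qed.

(** By homogeneity a zero on the sphere is a zero along the whole line. *)
Lemma homog_sphere_eq0 n f : f \is n.-homog ->
  (forall x, onS x -> f.@[x ord0] = 0) -> f = 0.
Proof.
move=> fn f0; apply: mpoly_fun_eq0 => v.
have -> : f.@[v] = f.@[(\row_i v i) ord0] by apply: meval_eq => i; rewrite mxE.
have [->|/unit_multiple[c _ [u uS ->]]] := eqVneq (\row_i v i) 0; last first.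
  by rewrite (homog_evZ _ _ fn) f0 ?mulr0.
rewrite -(scale0r (delta_mx ord0 ord0)) (homog_evZ _ _ fn) f0 ?mulr0 //.
by rewrite /onS dot_delta mxE !eqxx.
Qed.

(** Linear independence of the restrictions to the sphere. *)
Definition sphere_free (I : finType) (phi : I -> {mpoly R[d]}) :=
  forall v : I -> R,
  (forall x, onS x -> \sum_i v i * (phi i).@[x ord0] = 0) -> forall i, v i = 0.

Lemma mon_sphere_free n : sphere_free (@mon n).
Proof.
move=> v v0 m; pose f := \sum_(m : monomial_index n) v m *: mon m.
have f0 : f = 0.
  apply: (@homog_sphere_eq0 n) => [|x xS].
    by apply: rpred_sum => i _; rewrite rpredZ // mon_homog.
  rewrite -[RHS](v0 x xS) raddf_sum; apply: eq_bigr => i _ /=.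
  by rewrite mevalZ.
have := congr1 (mcoeff (val m)) f0; rewrite mcoeff0 raddf_sum (bigD1 m) //= big1.
  by rewrite mcoeffZ mcoeffX eqxx mulr1 addr0.
move=> k /eqP km; rewrite mcoeffZ mcoeffX; case: eqP => [e|]; last by rewrite mulr0.
by case: km; apply/val_inj.
Qed.

(** The Gram matrix is invertible: a vector v in its kernel satisfies J(f^2) = 0
    for f = sum_i v_i phi_i, so f vanishes on the sphere. *)
Lemma gram_inverse (J : {scalar {mpoly R[d]}}) (I : finType) (phi : I -> {mpoly R[d]}) :
  sphere_mean J -> sphere_free phi ->
  exists C : I -> I -> R, forall i l, \sum_j C i j * J (phi j * phi l) = (i == l)%:R.
Proof.
move=> HJ phi_free; apply: exists_left_inverse => v vA; apply: phi_free => x xS.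
pose f := \sum_i v i *: phi i.
have : J (f ^+ 2) = 0.
  rewrite expr2 {2}/f mulr_sumr linear_sum big1 // => l _.
  rewrite -scalerAr linearZ /= -[X in _ * J X]mulrC /f mulr_sumr linear_sum /=.
  rewrite (eq_bigr (fun i => v i * J (phi i * phi l))) ?vA ?mulr0 // => i _.
  by rewrite -scalerAr linearZ /= [phi l * _]mulrC.
move/(mean_sqr_eq0 HJ) => /(_ x xS) fx0; rewrite -[RHS]fx0 raddf_sum.
by apply: eq_bigr => i _ /=; rewrite mevalZ.
Qed.

End Monomials.

(** * Zonal reproducing kernels *)

Section Kernel.
Variables (R : rcfType) (p : nat).
Local Notation d := p.+2.
Variable (J : {scalar {mpoly R[d]}}).
Hypothesis HJ : sphere_mean J.
Implicit Types (x y z : 'rV[R]_d) (f g : {mpoly R[d]}) (h : {poly R}).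

Lemma mean_lin_perp x z m i : dot x z = 0 ->
  (m + i.+1 + p.+1)%:R * J (lin x ^+ m * lin z ^+ i.+2) =
  i.+1%:R * dot z z * J (lin x ^+ m * lin z ^+ i).
Proof.
move=> xz; have xm : lin x ^+ m \is m.-homog.
  by have := dhomogMn m (lin_homog x); rewrite mul1n.
rewrite mulrC [lin x ^+ m * _]mulrC mulrC (mean_linXM HJ) //=.
by rewrite dderXn dder_lin dotC xz mpolyC0 mulr0 scaler0 mulr0 linear0 addr0 [lin z ^+ i * _]mulrC.
Qed.

Lemma mean_zon_perp1 h x z : dot x z = 0 -> J (zon h x * lin z) = 0.
Proof.
move=> xz; rewrite zonE mulr_suml linear_sum big1 // => m _ /=.
have xm : lin x ^+ m \is m.-homog by have := dhomogMn m (lin_homog x); rewrite mul1n.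
have mp : (m + 0 + p.+1)%:R != 0 :> R by rewrite pnatr_eq0 addnS.
rewrite -scalerAl linearZ /=.
have /(mulfI mp) -> :
    (m + 0 + p.+1)%:R * J (lin x ^+ m * lin z) = (m + 0 + p.+1)%:R * 0.
  rewrite mulr0 mulrC [lin x ^+ m * _]mulrC -[lin z]expr1 mulrC (mean_linXM HJ) //=.
  by rewrite !mul0r add0r dderXn dder_lin dotC xz mpolyC0 mulr0 scaler0 mulr0 linear0.
by rewrite mulr0.
Qed.

(** For a vector z orthogonal to x, averaging over the rotations that fix x
    replaces (z.X)^2 by a multiple of |z|^2 (1 - (x.X)^2). Both sides are
    computed on h = t^m with [mean_lin_perp]. *)
Lemma mean_zon_perpSS h x z i : onS x -> dot x z = 0 ->
  J (zon h x * lin z ^+ i.+2) =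
  i.+1%:R / (i + p.+1)%:R * dot z z * J (zon (h * (1 - 'X^2)) x * lin z ^+ i).
Proof.
move=> xS xz; rewrite zonM zonB zonXn (_ : zon 1 x = 1); last exact: rmorph1.
rewrite zonE !mulr_suml !linear_sum mulr_sumr; apply: eq_bigr => m _ /=.
rewrite -!scalerAl !linearZ /= [RHS]mulrCA; congr (_ * _).
rewrite mulrBr mulr1 mulrBl linearB /= -exprD addn2.
have np : (m + i.+1 + p.+1)%:R != 0 :> R by rewrite pnatr_eq0 addnS.
have E1 := mean_lin_perp m i xz.
have zx : dot z x = 0 by rewrite dotC.
have := mean_lin_perp i m zx; rewrite xS mulr1 ![lin z ^+ i * _]mulrC => E2.
have E3 : (i + m.+1 = m + i.+1)%N by lia.
rewrite E3 in E2; apply: (mulfI np); rewrite E1 mulrCA mulrBr E2 -mulrBl.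
have -> : (m + i.+1 + p.+1)%:R - m.+1%:R = (i + p.+1)%:R :> R.
  by rewrite -natrB; [congr (_%:R)|]; lia.
have ip : (i + p.+1)%:R != 0 :> R by rewrite pnatr_eq0 addnS.
by move: (i + p.+1)%:R ip => c c0; field.
Qed.

(** A trace of rotation invariance; the recurrence for the moments of x.X does
    not involve x. *)
Lemma mean_lin_unit m x y : onS x -> onS y -> J (lin x ^+ m) = J (lin y ^+ m).
Proof.
move=> xS yS; elim/ltn_ind: m => -[_|m IHm]; first by rewrite !expr0.
have mp : (0 + m + p.+1)%:R != 0 :> R by rewrite pnatr_eq0 addnS.
have H z : onS z -> (0 + m + p.+1)%:R * J (lin z ^+ m.+1) = m%:R * J (lin z ^+ m.-1).
  move=> zS; have := mean_linXM HJ m z (@dhomog1 d R mdeg).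
  by rewrite dder1 !mulr1 mulr0 linear0 addr0 zS mulr1.
apply: (mulfI mp); rewrite !H //; case: m IHm {H mp} => [|m] IHm; first by rewrite !mul0r.
by rewrite (IHm m) //; lia.
Qed.

Lemma mean_zon_unit h x y : onS x -> onS y -> J (zon h x) = J (zon h y).
Proof.
move=> xS yS; rewrite !zonE !linear_sum; apply: eq_bigr => m _ /=.
by rewrite !linearZ /= (mean_lin_unit _ xS yS).
Qed.

(** Equal to one on the sphere; it raises the degree of a homogeneous polynomial
    by two without changing its values there. *)
Definition r2 : {mpoly R[d]} := \sum_i 'X_i ^+ 2.

Lemma r2_ev y : r2.@[y ord0] = dot y y.
Proof.
by rewrite raddf_sum; apply: eq_bigr => i _ /=; rewrite rmorphXn /= mevalXU expr2.
Qed.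

Lemma r2_homog : r2 \is 2.-homog.
Proof.
by apply: rpred_sum => i _; rewrite mpolyXn dhomogX; apply/eqP; rewrite /= mdegMn mdeg1.
Qed.

Lemma zonal_powers_free n x : onS x ->
  sphere_free (fun i : 'I_(n./2.+1) => lin x ^+ (n - 2 * i) * r2 ^+ i).
Proof.
move=> xS v v0 i; pose q : {poly R} := \sum_(i < n./2.+1) v i *: 'X^(n - 2 * i).
have q0 : q = 0.
  apply: (zonal_eq0 xS) => y yS; rewrite -[RHS](v0 y yS) horner_sum.
  apply: eq_bigr => j _.
  by rewrite hornerZ hornerXn mevalM !rmorphXn /= lin_ev r2_ev yS expr1n mulr1.
have := congr1 (fun r : {poly R} => r`_(n - 2 * i)) q0.
rewrite coef0 coef_sum (bigD1 i) //= coefZ coefXn eqxx mulr1 big1 ?addr0 // => j ji.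
rewrite coefZ coefXn; case: eqP => [e|]; last by rewrite mulr0.
case/eqP: ji; apply/val_inj => /=; have := ltn_ord i; have := ltn_ord j; lia.
Qed.

(** G represents the evaluation at t = 1 on the polynomials of degree at most n
    with the parity of n, for the inner product given by the mean of zonal
    functions. *)
Definition zonal_dual n (G : {poly R}) :=
  forall x l, onS x -> (l <= n./2)%N -> J (zon (G * 'X^(n - 2 * l)) x) = 1.

(** G is a combination of the t^(n-2j) with coefficients from the inverse Gram
    matrix of the functions (e.X)^(n-2j), for one unit vector e; by
    [mean_zon_unit] the same G works for all x. K x is the homogeneous form of
    G(x.-). *)
Lemma exists_zonal_dual n : exists (G : {poly R}) (K : 'rV[R]_d -> {mpoly R[d]}),
  [/\ (size G <= n.+1)%N, forall x, K x \is n.-homog,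
      forall x y, onS y -> (K x).@[y ord0] = G.[dot x y] & zonal_dual n G].
Proof.
pose e : 'rV[R]_d := delta_mx ord0 ord0.
have eS : onS e by rewrite /onS dot_delta mxE !eqxx.
have [C CP] := gram_inverse HJ (zonal_powers_free (n := n) eS).
pose w j := \sum_i C i j.
pose G : {poly R} := \sum_(j < n./2.+1) w j *: 'X^(n - 2 * j).
pose K x := \sum_(j < n./2.+1) w j *: (lin x ^+ (n - 2 * j) * r2 ^+ j).
have KG x y : onS y -> (K x).@[y ord0] = G.[dot x y].
  move=> yS; rewrite raddf_sum horner_sum; apply: eq_bigr => j _ /=.
  by rewrite mevalZ mevalM !rmorphXn /= lin_ev r2_ev yS expr1n mulr1 hornerZ hornerXn.
exists G, K; split => //.
- apply: (leq_trans (size_sum _ _ _)); apply/bigmax_leqP => j _.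
  by apply: (leq_trans (size_scale_leq _ _)); rewrite size_polyXn ltnS leq_subr.
- move=> x; apply: rpred_sum => j _; rewrite rpredZ //.
  have : lin x ^+ (n - 2 * j) * r2 ^+ j \is (1 * (n - 2 * j) + 2 * j).-homog.
    by apply: dhomogM; apply: dhomogMn; [exact: lin_homog|exact: r2_homog].
  by rewrite mul1n subnK //; have := ltn_ord j; lia.
- move=> x l xS ln; rewrite (mean_zon_unit _ xS eS).
  have ln' : (l < n./2.+1)%N by [].
  pose l' := Ordinal ln'.
  transitivity (J (K e * (lin e ^+ (n - 2 * l') * r2 ^+ l'))).
    apply: (mean_ext HJ) => y yS; rewrite zon_ev hornerM hornerXn !mevalM KG //.
    by rewrite !rmorphXn /= lin_ev r2_ev yS expr1n mulr1.
  rewrite mulr_suml linear_sum /=.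
  transitivity (\sum_i \sum_j C i j *
     J ((lin e ^+ (n - 2 * j) * r2 ^+ j) * (lin e ^+ (n - 2 * l') * r2 ^+ l'))).
    rewrite exchange_big; apply: eq_bigr => j _.
    by rewrite -scalerAl linearZ /= mulr_suml.
  rewrite (eq_bigr (fun i => (i == l')%:R)) => [|i _]; last exact: CP.
  by rewrite (bigD1 l') //= eqxx big1 ?addr0 // => i /negPf ->.
Qed.

(** For b > 0 the polynomial t^a (1 - t^2)^b vanishes at t = 1. *)
Lemma zonal_dual_pow n G : zonal_dual n G -> forall x b a l, onS x ->
  (a + 2 * b + 2 * l = n)%N ->
  J (zon (G * 'X^a * (1 - 'X^2) ^+ b) x) = (b == 0%N)%:R.
Proof.
move=> GP x b a l xS; elim: b a l => [|b IHb] a l abl.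
  have -> : a = (n - 2 * l)%N by lia.
  by rewrite expr0 mulr1 GP //; lia.
have -> : G * 'X^a * (1 - 'X^2) ^+ b.+1 =
   G * 'X^a * (1 - 'X^2) ^+ b - G * 'X^(a.+2) * (1 - 'X^2) ^+ b.
  by rewrite !exprS; ring.
by rewrite zonB linearB /= (IHb a l.+1) ?(IHb a.+2 l) ?subrr //; lia.
Qed.

(** [mean_zon_perpSS] trades two factors z.X for a factor 1 - t^2, until no z is
    left and [zonal_dual_pow] applies. *)
Lemma zonal_dual_perp n G : zonal_dual n G -> forall x z i b a, onS x -> dot x z = 0 ->
  (0 < i)%N -> (a + 2 * b + i = n)%N ->
  J (zon (G * 'X^a * (1 - 'X^2) ^+ b) x * lin z ^+ i) = 0.
Proof.
move=> GP x z; elim/ltn_ind => i IHi b a xS xz i0 abi.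
case: i i0 IHi abi => // -[_ _ _|i _ IHi abi]; first by rewrite expr1 mean_zon_perp1.
rewrite mean_zon_perpSS // -(mulrA _ ((1 - 'X^2) ^+ b)) -exprSr; case: (posnP i) => [i0|i0].
  by rewrite i0 expr0 mulr1 (zonal_dual_pow GP (l := 0)) ?mulr0 //; lia.
by rewrite IHi ?mulr0 //; lia.
Qed.

(** By [power_span] it is enough to take g = (z.X)^n. Split z as (x.z) x + z'
    with z' orthogonal to x and expand: all the terms with a factor z'.X have
    mean zero, and so does their value at x. *)
Lemma zonal_dual_reproducing n G : zonal_dual n G ->
  forall x g, onS x -> g \is n.-homog -> J (zon G x * g) = g.@[x ord0].
Proof.
move=> GP x g xS; pose E g := J (zon G x * g) - g.@[x ord0].
suff H : g \is n.-homog -> E g = 0 by move/H/eqP; rewrite subr_eq0 => /eqP.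
have linE : scalar E.
  by move=> c f f'; rewrite /E mulrDr -scalerAr linearP mevalD mevalZ /=; ring.
move: g; apply: (power_span linE) => z; rewrite /E rmorphXn /= lin_ev.
pose z' := z - dot x z *: x.
have xz' : dot x z' = 0 by rewrite !dotE xS mulr1 subrr.
have zE : z = dot x z *: x + 1 *: z' by rewrite scale1r addrC subrK.
rewrite {1}zE lin_comb scale1r exprDn mulr_sumr linear_sum big_ord_recl /= subn0.
rewrite bin0 mulr1n expr0 mulr1 exprZn -scalerAr linearZ /= -zonXn -zonM.
rewrite (_ : J _ = 1); last by have := GP x 0 xS; rewrite muln0 subn0; apply.
rewrite mulr1 big1 ?addr0 => [|i _]; first by rewrite dotC subrr.
rewrite mulrnAr raddfMn /= exprZn -!scalerAl -scalerAr linearZ /= mulrA -zonXn -zonM.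
have := zonal_dual_perp GP (i := lift ord0 i) (b := 0) (a := (n - lift ord0 i)%N) xS xz'.
rewrite expr0 mulr1 => -> //; first by rewrite mulr0 mul0rn.
by have := ltn_ord i; rewrite /= /bump; lia.
Qed.

(** The value G(1) is a trace. If C is the inverse of the Gram matrix of the
    monomials m_i, the reproducing kernel on the diagonal is sum C_ij m_i(x)
    m_j(x); it is the constant G(1) on the sphere, and its mean is the trace of
    the identity. *)
Theorem exists_zonal_kernel n : exists (G : {poly R}) (K : 'rV[R]_d -> {mpoly R[d]}),
  [/\ (size G <= n.+1)%N, forall x, K x \is n.-homog,
      forall x y, onS y -> (K x).@[y ord0] = G.[dot x y],
      forall x g, onS x -> g \is n.-homog -> J (K x * g) = g.@[x ord0] &
      G.[1] = 'C(p.+1 + n, n)%:R].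
Proof.
have [G [K [Gn Kn KG GP]]] := exists_zonal_dual n.
have Krep x g : onS x -> g \is n.-homog -> J (K x * g) = g.@[x ord0].
  move=> xS gn; rewrite -(zonal_dual_reproducing GP xS gn).
  by apply: (mean_ext HJ) => y yS; rewrite !mevalM KG // zon_ev.
exists G, K; split => //.
have [C CA] := gram_inverse HJ (@mon_sphere_free R p.+1 n).
pose A (i j : monomial_index p.+1 n) := J (mon R i * mon R j).
have AC := left_inverse_right (erefl _) CA.
pose Q := \sum_(i : monomial_index p.+1 n) \sum_j C i j *: (mon R j * mon R i).
have QG x : onS x -> Q.@[x ord0] = G.[1].
  move=> xS; have := KG x x xS; rewrite xS => <-.
  pose k (i : monomial_index p.+1 n) := (K x)@_(val i).
  have kA l : \sum_i k i * A i l = (mon R l).@[x ord0].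
    rewrite -(Krep x (mon R l)) ?mon_homog // (homog_mon (Kn x)) mulr_suml linear_sum.
    by apply: eq_bigr => i _ /=; rewrite -scalerAl linearZ.
  have kE j : k j = \sum_l (mon R l).@[x ord0] * C l j.
    transitivity (\sum_i k i * (i == j)%:R).
      by rewrite (bigD1 j) //= eqxx mulr1 big1 ?addr0 // => i /negPf ->; rewrite mulr0.
    under eq_bigr do rewrite -AC mulr_sumr.
    rewrite exchange_big; apply: eq_bigr => l _ /=; rewrite -kA mulr_suml.
    by apply: eq_bigr => i _; rewrite mulrA.
  have -> : (K x).@[x ord0] = \sum_j k j * (mon R j).@[x ord0].
    rewrite {1}(homog_mon (Kn x)) raddf_sum; apply: eq_bigr => j _ /=.
    by rewrite mevalZ.
  have -> : Q.@[x ord0] =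
      \sum_i \sum_j C i j * ((mon R j).@[x ord0] * (mon R i).@[x ord0]).
    rewrite raddf_sum; apply: eq_bigr => i _ /=; rewrite raddf_sum.
    by apply: eq_bigr => j _ /=; rewrite mevalZ mevalM.
  rewrite exchange_big; apply: eq_bigr => j _; rewrite kE mulr_suml.
  by apply: eq_bigr => l _; ring.
have <- : J Q = G.[1].
  transitivity (J (G.[1] *: 1)); last by rewrite linearZ /= (mean1 HJ) mulr1.
  by apply: (mean_ext HJ) => x xS; rewrite QG // mevalZ meval1 mulr1.
rewrite linear_sum (eq_bigr (fun=> 1)) => [|i _]; last first.
  transitivity ((i == i)%:R : R); last by rewrite eqxx.
  rewrite -CA.
  by rewrite linear_sum; apply: eq_bigr => j _ /=; rewrite linearZ.
by rewrite sumr_const card_monomial_index.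
Qed.

End Kernel.

(** * Interpolation by zonal polynomials *)

(** All the monomials of h have degrees of the parity of n. *)
Definition parity_poly (R : nzRingType) n (h : {poly R}) :=
  forall i, h`_i != 0 -> odd i = odd n.

Section Forward.
Variables (R : rcfType) (p : nat).
Local Notation d := p.+2.
Implicit Types (x y z : 'rV[R]_d) (f g : {mpoly R[d]}) (h q : {poly R}).

(** The term t^i becomes (x.X)^i |X|^(n-i), a polynomial since n - i is even. *)
Lemma zonal_homogenize n h x : (size h <= n.+1)%N -> parity_poly n h ->
  exists2 f, f \is n.-homog & forall y, onS y -> f.@[y ord0] = h.[dot x y].
Proof.
move=> hn hpar; pose f := \sum_(i < size h) h`_i *: (lin x ^+ i * r2 R p ^+ (n - i)./2).
exists f => [|y yS]; last first.
  rewrite raddf_sum horner_coef; apply: eq_bigr => i _ /=.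
  by rewrite mevalZ mevalM !rmorphXn /= lin_ev r2_ev yS expr1n mulr1.
apply: rpred_sum => i _; have [->|hi] := eqVneq h`_i 0.
  by rewrite scale0r rpred0.
rewrite rpredZ //.
have fh : lin x ^+ i * r2 R p ^+ (n - i)./2 \is (1 * i + 2 * (n - i)./2).-homog.
  by apply: dhomogM; apply: dhomogMn; [exact: lin_homog|exact: r2_homog].
suff E : (1 * i + 2 * (n - i)./2 = n)%N by rewrite E in fh.
have i_n : (i <= n)%N by have := ltn_ord i; lia.
have := odd_double_half (n - i); rewrite oddB // (hpar _ hi) addbb -muln2; lia.
Qed.

(** The coefficient matrix of the h_i in the basis psi is a left inverse of the
    evaluation matrix of psi at the points, hence a right inverse as the two
    index sets have the same size. *)
Lemma interpolation_of_dual (I L : finType) (psi : L -> {mpoly R[d]})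
    (pt : I -> 'rV[R]_d) (h : I -> {poly R}) :
  #|I| = #|L| -> (forall i, onS (pt i)) ->
  (forall i, exists c : L -> R, forall y, onS y ->
    (h i).[dot (pt i) y] = \sum_l c l * (psi l).@[y ord0]) ->
  (forall i j, (h i).[dot (pt i) (pt j)] = (i == j)%:R) ->
  forall l y, onS y ->
    (psi l).@[y ord0] = \sum_i (psi l).@[pt i ord0] * (h i).[dot (pt i) y].
Proof.
move=> IL ptS /fin_all_exists[C CP] hd l y yS.
have CA i i' : \sum_l C i l * (psi l).@[pt i' ord0] = (i == i')%:R by rewrite -CP.
have AC := left_inverse_right IL CA.
under eq_bigr do rewrite CP // mulr_sumr.
rewrite exchange_big /=; transitivity (\sum_l' (l == l')%:R * (psi l').@[y ord0]).
  rewrite (bigD1 l) //= eqxx mul1r big1 ?addr0 // => l'.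
  by rewrite eq_sym => /negPf ->; rewrite mul0r.
apply: eq_bigr => l' _; rewrite -AC mulr_suml.
by apply: eq_bigr => i _; rewrite mulrA.
Qed.

Lemma interpolation_homog (I : finType) (pt : I -> 'rV[R]_d) (h : I -> {poly R}) n y :
  (forall m : monomial_index p.+1 n,
    (mon R m).@[y ord0] = \sum_i (mon R m).@[pt i ord0] * (h i).[dot (pt i) y]) ->
  forall g, g \is n.-homog ->
    g.@[y ord0] = \sum_i g.@[pt i ord0] * (h i).[dot (pt i) y].
Proof.
move=> monP g gn.
have E z : g.@[z ord0] = \sum_(m : monomial_index p.+1 n) g@_(val m) * (mon R m).@[z ord0].
  rewrite {1}(homog_mon gn) raddf_sum; apply: eq_bigr => m _ /=.
  by rewrite mevalZ.
rewrite E; under eq_bigr do rewrite monP mulr_sumr.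
rewrite exchange_big; apply: eq_bigr => i _ /=; rewrite E mulr_suml.
by apply: eq_bigr => m _; rewrite mulrA.
Qed.

Section Dual.
Variables (I : finType) (pt : I -> 'rV[R]_d) (h : I -> {poly R}) (n : nat).
Hypotheses (ptS : forall i, onS (pt i)) (h_size : forall i, (size (h i) <= n.+1)%N)
  (h_dual : forall i j, (h i).[dot (pt i) (pt j)] = (i == j)%:R).

Let h1 i : (h i).[1] = 1.
Proof. by have := h_dual i i; rewrite ptS eqxx. Qed.

Let h_neq0 i : h i != 0.
Proof. by apply: contra_eq_neq (h1 i) => ->; rewrite horner0 eq_sym oner_eq0. Qed.

Lemma interpolation_odd : #|I| = 'C(p.+1 + n, n) -> (forall i, parity_poly n (h i)) ->
  forall g y, g \is n.-homog -> onS y ->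
    g.@[y ord0] = \sum_i g.@[pt i ord0] * (h i).[dot (pt i) y].
Proof.
move=> In h_par g y gn yS; apply: interpolation_homog gn => m.
apply: (interpolation_of_dual (psi := @mon R p.+1 n)) => // [|i].
  by rewrite card_monomial_index.
have [f fn fE] := zonal_homogenize (pt i) (h_size i) (h_par i).
exists (fun m => f@_(val m)) => z zS; rewrite -fE // {1}(homog_mon fn) raddf_sum.
by apply: eq_bigr => m' _ /=; rewrite mevalZ.
Qed.

(** Otherwise the degree drops by two, by parity, and h_i(t) (t^2 - 1) still has
    the right degree and parity for [interpolation_odd]; it vanishes at all the
    points. *)
Lemma dual_size_odd : #|I| = 'C(p.+1 + n, n) -> (forall i, parity_poly n (h i)) ->
  forall i, size (h i) = n.+1.
Proof.
move=> In h_par i; apply/eqP; rewrite eqn_leq h_size /= ltnNge; apply/negP => hn.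
pose q := h i * ('X^2 - 1).
have hn1 : (size (h i) <= n.-1)%N.
  rewrite leqNgt; apply/negP => hn1.
  have sz : size (h i) = n by apply/eqP; rewrite eqn_leq hn (leq_trans (leqSpred n)).
  have n0 : (0 < n)%N by rewrite -sz lt0n size_poly_eq0.
  have := h_par i n.-1; rewrite -[X in _`_X.-1]sz -/(lead_coef (h i)) lead_coef_eq0.
  move=> /(_ (h_neq0 i)); rewrite -[in odd n](prednK n0) /=.
  by case: (odd n.-1).
have n1 : (0 < n.-1)%N by apply: leq_trans hn1; rewrite lt0n size_poly_eq0.
have qn : (size q <= n.+1)%N.
  apply: (leq_trans (size_polyMleq _ _)); rewrite size_XnsubC //; lia.
have q_par : parity_poly n q.
  move=> j; rewrite /q mulrBr mulr1 coefB coefMXn.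
  case: ltnP => j2 qj.
    by apply: (h_par i); move: qj; rewrite sub0r oppr_eq0.
  have [h2|] := eqVneq (h i)`_(j - 2) 0; last by move/(h_par i); rewrite oddB // addbF.
  by apply: (h_par i); move: qj; rewrite h2 sub0r oppr_eq0.
have [f fn fE] := zonal_homogenize (pt i) qn q_par.
have q0 : q = 0.
  apply: (zonal_eq0 (ptS i)) => y yS; rewrite -fE // (interpolation_odd In h_par fn yS).
  apply: big1 => j _; rewrite fE // hornerM h_dual; case: eqP => [->|_]; last by rewrite !mul0r.
  by rewrite ptS !hornerE ?expr1n ?mulr1 subrr !(mulr0, mul0r).
have /eqP := q0; rewrite mulf_eq0 (negPf (h_neq0 i)) /= -size_poly_eq0.
by rewrite size_XnsubC.
Qed.

End Dual.

Section DualEven.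
Variables (I : finType) (pt : I -> 'rV[R]_d) (h : I -> {poly R}) (n : nat).
Hypotheses (ptS : forall i, onS (pt i)) (h_size : forall i, (size (h i) <= n.+2)%N)
  (h_dual : forall i j, (h i).[dot (pt i) (pt j)] = (i == j)%:R)
  (In : #|I| = ('C(p.+1 + n.+1, n.+1) + 'C(p.+1 + n, n))%N).

(** The two parities of q are homogenised separately. *)
Lemma zonal_homogenize2 q x : (size q <= n.+2)%N ->
  exists f g, [/\ f \is n.+1.-homog, g \is n.-homog &
    forall y, onS y -> f.@[y ord0] + g.@[y ord0] = q.[dot x y]].
Proof.
move=> qn.
pose q1 := \poly_(i < n.+2) (if odd i == odd n.+1 then q`_i else 0).
pose q2 := \poly_(i < n.+1) (if odd i == odd n then q`_i else 0).
have [f fn fE] : exists2 f, f \is n.+1.-homog & forall y, onS y -> f.@[y ord0] = q1.[dot x y].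
  apply: zonal_homogenize; first exact: size_poly.
  move=> i; rewrite coef_poly; case: ltnP => _; last by rewrite eqxx.
  by case: (odd i =P _) => // _; rewrite eqxx.
have [g gn gE] : exists2 g, g \is n.-homog & forall y, onS y -> g.@[y ord0] = q2.[dot x y].
  apply: zonal_homogenize; first exact: size_poly.
  move=> i; rewrite coef_poly; case: ltnP => _; last by rewrite eqxx.
  by case: (odd i =P _) => // _; rewrite eqxx.
exists f, g; split => // y yS; rewrite fE // gE // -hornerD; congr (_.[_]).
apply/polyP => i; rewrite coefD !coef_poly.
have [i2|i2] := leqP n.+2 i; first by rewrite ltnNge (ltnW i2) addr0 nth_default // (leq_trans qn).
have [->|i1] := eqVneq i n.+1; first by rewrite ltnn eqxx addr0.
have -> : (i < n.+1)%N by lia.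
by rewrite /=; case: (odd i); case: (odd n); rewrite /= ?add0r ?addr0.
Qed.

Lemma interpolation_even g y : g \is n.+1.-homog \/ g \is n.-homog -> onS y ->
    g.@[y ord0] = \sum_i g.@[pt i ord0] * (h i).[dot (pt i) y].
Proof.
move=> gn yS.
pose psi (l : monomial_index p.+1 n.+1 + monomial_index p.+1 n) :=
  match l with inl m => mon R m | inr m => mon R m end.
have psiP l : (psi l).@[y ord0] = \sum_i (psi l).@[pt i ord0] * (h i).[dot (pt i) y].
  apply: interpolation_of_dual => // [|i].
    by rewrite card_sum !card_monomial_index.
  have [f [f' [fn fn' fE]]] := zonal_homogenize2 (pt i) (h_size i).
  exists (fun l => match l with inl m => f@_(val m) | inr m => f'@_(val m) end) => z zS.
  rewrite -fE // big_sumType /= {1}(homog_mon fn) {1}(homog_mon fn') !raddf_sum /=.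
  by congr (_ + _); apply: eq_bigr => m _; rewrite mevalZ.
case: gn => gn; apply: interpolation_homog gn => m; first exact: (psiP (inl m)).
exact: (psiP (inr m)).
Qed.

(** Otherwise h_i(t) (t - 1) would be recovered from its values at the points,
    which are all zero. *)
Lemma dual_size_even i : size (h i) = n.+2.
Proof.
have h1 : (h i).[1] = 1 by have := h_dual i i; rewrite ptS eqxx.
have h0 : h i != 0 by apply: contra_eq_neq h1 => ->; rewrite horner0 eq_sym oner_eq0.
apply/eqP; rewrite eqn_leq h_size /= ltnNge; apply/negP => hn.
pose q := h i * ('X - 1%:P).
have qn : (size q <= n.+2)%N.
  by apply: (leq_trans (size_polyMleq _ _)); rewrite size_XsubC addn2.
have [f [g [fn gn fgE]]] := zonal_homogenize2 (pt i) qn.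
have q0 : q = 0.
  apply: (zonal_eq0 (ptS i)) => y yS; rewrite -fgE //.
  rewrite (interpolation_even (or_introl fn) yS) (interpolation_even (or_intror gn) yS).
  rewrite -big_split; apply: big1 => j _ /=.
  rewrite -mulrDl fgE // hornerM h_dual; case: eqP => [->|_]; last by rewrite !mul0r.
  by rewrite ptS !hornerE subrr !(mulr0, mul0r).
have /eqP := q0; rewrite mulf_eq0 (negPf h0) /= -size_poly_eq0.
by rewrite size_XsubC.
Qed.

End DualEven.

End Forward.

(** * Weighted designs *)

Section Designs.
Variables (R : rcfType) (d : nat).
Implicit Types (x y z : 'rV[R]_d) (f g : {mpoly R[d]}) (h q : {poly R}).

(** Exactness in degrees up to t of the quadrature with nodes pt and weights w,
    with signed weights and arbitrary nodes. *)
Definition design (J : {mpoly R[d]} -> R) t (I : finType) (w : I -> R) (pt : I -> 'rV[R]_d) :=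
  forall f, (msize f <= t.+1)%N -> J f = \sum_i w i * f.@[pt i ord0].

Lemma msize_homog n f : f \is n.-homog -> (msize f <= n.+1)%N.
Proof.
move=> /dhomogP fn; rewrite msizeE big_seq; apply/bigmax_leqP_seq => m mf _.
by rewrite ltnS (_ : mdeg m = n) //; exact: fn.
Qed.

Lemma msize_zon h x : (msize (zon h x) <= (size h).-1.+1)%N.
Proof.
rewrite zonE; apply: (leq_trans (msize_sum _ _ _)); apply/bigmax_leqP => i _.
apply: (leq_trans (msizeZ_le _ _)); apply: (@leq_trans i.+1); last by have := ltn_ord i; lia.
by apply: msize_homog; have := dhomogMn i (lin_homog x); rewrite mul1n.
Qed.

Lemma design_zonal J t (I : finType) (w : I -> R) pt h x : design J t w pt ->
  (size h <= t.+1)%N -> J (zon h x) = \sum_i w i * h.[dot x (pt i)].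
Proof.
move=> HD ht; rewrite HD; first by apply: eq_bigr => i _; rewrite zon_ev.
by apply: (leq_trans (msize_zon _ _)); lia.
Qed.

(** The weights of a design are determined by the nodes as soon as the
    evaluations at the nodes have dual functions of degree at most t. *)
Lemma design_weight J t (I : finType) (w : I -> R) pt (h : I -> {poly R}) :
  design J t w pt -> (forall i, size (h i) <= t.+1)%N ->
  (forall i j, (h i).[dot (pt i) (pt j)] = (i == j)%:R) ->
  forall i, w i = J (zon (h i) (pt i)).
Proof.
move=> HD ht hd i; rewrite (design_zonal _ HD (ht i)) (bigD1 i) //= hd eqxx mulr1.
by rewrite big1 ?addr0 // => j ji; rewrite hd eq_sym (negPf ji) mulr0.
Qed.

Lemma dot_unit_itv x y : onS x -> onS y -> -1 <= dot x y <= 1.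
Proof.
move=> xS yS; have := dot_ge0 (x - y); have := dot_ge0 (x + y).
by rewrite !dotE (dotC y x) xS yS => h1 h2; apply/andP; split; lra.
Qed.

End Designs.

Section TightWeights.
Variables (R : realFieldType) (I : finType) (w : I -> R) (phi : I -> I -> R) (N : R).
Hypotheses (w_gt0 : forall i, 0 < w i) (w_sum : \sum_i w i = 1) (IN : #|I|%:R = N)
  (phi_ge0 : forall i j, 0 <= phi i j) (phi_diag : forall i, phi i i = N ^+ 2)
  (phi_mean : forall i, \sum_j w j * phi i j = N).

(** Keeping only the term j = i of [phi_mean] gives w_i N <= 1, and the average
    of these inequalities over i is an equality. *)
Lemma tight_weights i : w i = N^-1 /\ forall j, j != i -> phi i j = 0.
Proof.
have N0 : 0 < N.
  rewrite -IN ltr0n; apply/card_gt0P; exists i; by [].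
have split_i k : w k * N ^+ 2 + \sum_(j | j != k) w j * phi k j = N.
  by rewrite -[RHS](phi_mean k) [RHS](bigD1 k) //= phi_diag.
have rest_ge0 k : 0 <= \sum_(j | j != k) w j * phi k j.
  by apply: sumr_ge0 => j _; rewrite mulr_ge0 // ltW.
have wN k : w k * N <= 1.
  by rewrite -(ler_pM2r N0) mul1r -mulrA -expr2 -[leRHS](split_i k) lerDl.
have wN1 k : w k * N = 1.
  have : \sum_k (1 - w k * N) == 0.
    by rewrite sumrB -mulr_suml w_sum mul1r sumr_const IN subrr.
  rewrite psumr_eq0 => [/allP h|l _]; last by rewrite subr_ge0.
  by have := h k (mem_index_enum _); rewrite subr_eq0 => /eqP.
split; first by rewrite -[LHS]mulr1 -(divff (lt0r_neq0 N0)) mulrA wN1 mul1r.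
have /eqP : \sum_(j | j != i) w j * phi i j = 0.
  have := split_i i; rewrite expr2 mulrA wN1 mul1r => E; lra.
rewrite psumr_eq0 => [/allP h j ji|j _]; last by rewrite mulr_ge0 // ltW.
have := h j (mem_index_enum _); rewrite ji /= mulf_eq0.
by rewrite gt_eqF //= => /eqP.
Qed.

End TightWeights.

Section HalfSum.
Variables (R : rcfType) (d : nat) (X : {fset 'rV[R]_d}).
Hypotheses (XS : forall x, x \in X -> onS x) (XN : forall x, x \in X -> - x \in X).
Implicit Types x : 'rV[R]_d.

(** The choice operator depends only on the extent of its predicate, so x and -x
    get the same representative. *)
Definition half_repr (x : 'rV[R]_d) : 'rV[R]_d := choose (pred2 x (- x)) x.

Lemma half_reprP x : half_repr x = x \/ half_repr x = - x.
Proof.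
have : pred2 x (- x) (half_repr x) by apply: chooseP; rewrite /= eqxx.
by case/orP => /eqP; [left|right].
Qed.

Lemma half_reprN x : half_repr (- x) = half_repr x.
Proof.
rewrite /half_repr (eq_choose (_ : pred2 (- x) (- - x) =1 pred2 x (- x))) => [|y].
  by apply: choose_id; rewrite /= eqxx ?orbT.
by rewrite /= opprK orbC.
Qed.

Lemma opp_neq x : onS x -> - x != x.
Proof.
move=> xS; apply/eqP => /(congr1 (dot x)); rewrite dotNr xS => ?; lra.
Qed.

Lemma half_repr_opp x : onS x -> (half_repr (- x) == - x) = (half_repr x != x).
Proof.
move=> xS; rewrite half_reprN; case: (half_reprP x) => ->.
  by rewrite eqxx eq_sym (negPf (opp_neq xS)).
by rewrite eqxx opp_neq.
Qed.

Lemma half_sum (V : nmodType) (F : 'rV[R]_d -> V) :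
  \sum_(x <- X) F x = \sum_(x <- X | half_repr x == x) (F x + F (- x)).
Proof.
rewrite big_split (bigID (fun x => half_repr x == x)) /=; congr (_ + _).
have pX : perm_eq X [seq - x | x <- X].
  apply: uniq_perm; rewrite ?(map_inj_uniq oppr_inj) ?fset_uniq // => x.
  apply/idP/mapP => [xX|[y yX ->]]; last exact: XN.
  by exists (- x); rewrite ?opprK // XN.
rewrite (perm_big _ pX) big_map big_seq_cond [RHS]big_seq_cond.
apply: eq_bigl => x; case xX : (x \in X) => //=.
by rewrite half_repr_opp ?negbK //; exact: XS.
Qed.

End HalfSum.

Section DesignsOnSphere.
Variables (R : rcfType) (p : nat).
Local Notation d := p.+2.
Variable (J : {scalar {mpoly R[d]}}).
Hypothesis HJ : sphere_mean J.
Implicit Types (x y z : 'rV[R]_d) (f g : {mpoly R[d]}) (h q : {poly R}).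

(** On the sphere a homogeneous polynomial of degree j <= N + 1 agrees with its
    product by the power of |X|^2 that brings it to degree N + 1 or N. *)
Lemma design_of_top_degrees (I : finType) (w : I -> R) pt N : (forall i, onS (pt i)) ->
  (forall f, f \is N.+1.-homog \/ f \is N.-homog ->
     J f = \sum_i w i * f.@[pt i ord0]) ->
  design J N.+1 w pt.
Proof.
move=> ptS top f fN; pose E g := J g - \sum_i w i * g.@[pt i ord0].
suff : E f = 0 by move/eqP; rewrite subr_eq0 => /eqP.
have linE : scalar E := quadrature_error_scalar J w pt.
rewrite (@pihomog_partitionE _ _ mdeg _ f fN) linform_sum //.
apply: big1 => j _; move: (pihomogP mdeg j f); move: (pihomog _ _ f) => g gj.
have jN : (j <= N.+1)%N by have := ltn_ord j; lia.
(* The exponent of |X|^2 that brings degree j to N if N - j is even, and to N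
   + 1 otherwise; in the case j = N + 1 truncated subtraction makes N - j
   zero. *)
pose e := if odd (N - j) == false then (if (j <= N)%N then (N - j)./2 else 0%N) else (N.+1 - j)./2.
have eh : r2 R p ^+ e * g \is N.+1.-homog \/ r2 R p ^+ e * g \is N.-homog.
  have h k : (2 * e + j = k)%N -> r2 R p ^+ e * g \is k.-homog.
    by move=> <-; apply: dhomogM => //; apply: dhomogMn; exact: r2_homog.
  rewrite /e in h *; case: (leqP j N) h => [jN'|jN'] h.
    case: eqP h => [ev|od] h; [right|left]; apply: h.
      by have := odd_double_half (N - j); rewrite ev -muln2; lia.
    have := odd_double_half (N.+1 - j); rewrite subSn //= -muln2.
    by case: (odd (N - j)) od => //=; lia.
  left; apply: h; have -> : (N - j = 0)%N by lia.
  by rewrite /=; lia.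
have := top _ eh; rewrite /E => Et.
have -> : J g = J (r2 R p ^+ e * g).
  by apply: (mean_ext HJ) => x xS; rewrite mevalM rmorphXn /= r2_ev xS expr1n mul1r.
rewrite Et -sumrB big1 // => i _.
by rewrite mevalM rmorphXn /= r2_ev ptS expr1n mul1r subrr.
Qed.

Theorem design_of_dual_even (I : finType) (pt : I -> 'rV[R]_d) (h : I -> {poly R}) n :
  (forall i, onS (pt i)) -> (forall i, (size (h i) <= n.+2)%N) ->
  (forall i j, (h i).[dot (pt i) (pt j)] = (i == j)%:R) ->
  #|I| = ('C(p.+1 + n.+1, n.+1) + 'C(p.+1 + n, n))%N ->
  (forall i, 0 < lead_coef (h i)) ->
  exists w : I -> R, (forall i, 0 < w i) /\ design J (2 * n.+1) w pt.
Proof.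
move=> ptS hn hd In lc; exists (fun i => funk R p n.+1 * (h i)`_n.+1); split => [i|].
  have := lc i; rewrite lead_coefE (dual_size_even ptS hn hd In).
  by apply: mulr_gt0; exact: funk_gt0.
rewrite (_ : 2 * n.+1 = (n.+1 + n).+1)%N; last by lia.
apply: design_of_top_degrees => // f fn.
have interp g y gn := @interpolation_even R p I pt h n ptS hn hd In g y gn.
case: fn => fn.
  apply: (quadrature_of_interpolation HJ (m := n.+1)) => // [g y gn yS|].
    by apply: interp => //; left.
  by rewrite (_ : n.+1 + n.+1 = (n.+1 + n).+1)%N //; lia.
apply: (quadrature_of_interpolation HJ (m := n)) => // g y gn yS.
by apply: interp => //; right.
Qed.

(** A weight computed on the representatives of the antipodal pairs is shared
    equally between the two points. In odd degrees both sides vanish. *)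
Theorem design_of_dual_odd (X : {fset 'rV[R]_d}) (h : 'rV[R]_d -> {poly R}) n :
  (forall x, x \in X -> onS x) -> (forall x, x \in X -> - x \in X) ->
  #|` X| = (2 * 'C(p.+1 + n, n))%N ->
  (forall x, x \in X -> (size (h x) <= n.+1)%N) ->
  (forall x, x \in X -> parity_poly n (h x)) ->
  (forall x, x \in X -> (h x).[1] = 1) ->
  (forall x y, x \in X -> y \in X -> x != y -> x != - y -> (h x).[dot x y] = 0) ->
  (forall x, x \in X -> 0 < lead_coef (h x)) ->
  exists w : X -> R, (forall i, 0 < w i) /\ design J (2 * n).+1 w val.
Proof.
move=> XS XN cX hn hpar h1 hd lc.
pose Y := [fset x in X | half_repr x == x]%fset.
have inY (i : Y) : val i \in X /\ half_repr (val i) = val i.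
  by have := valP i; rewrite !inE /= => /andP[-> /eqP].
have YX (i : Y) : val i \in X by have [] := inY i.
pose W x := funk R p n * (h x)`_n.
have cY : #|{: Y}| = 'C(p.+1 + n, n).
  have := half_sum XS XN (fun=> 1%N); rewrite [RHS]big_fset_condE -/Y big_split /=.
  move=> E; have {}E : #|` X| = (#|` Y| + #|` Y|)%N by rewrite !card_fset_sum1.
  by apply/eqP; rewrite -(eqn_pmul2l (isT : 0 < 2)%N) -cX mul2n -addnn E cardfE.
have hdY (i j : Y) : (h (val i)).[dot (val i) (val j)] = (i == j)%:R.
  have [iX ri] := inY i; have [jX rj] := inY j.
  have [->|ij] := eqVneq i j; first by rewrite XS // h1.
  rewrite hd //; apply/eqP => e; move: ij; rewrite -(inj_eq val_inj) => /eqP; apply.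
  by rewrite -ri -rj e half_reprN.
have hnY (i : Y) : (size (h (val i)) <= n.+1)%N by exact: hn.
have hparY (i : Y) : parity_poly n (h (val i)) by exact: hpar.
have YS (i : Y) : onS (val i) by exact: XS.
have Wpos x : x \in Y -> 0 < W x.
  move=> xY; have := lc _ (YX [` xY]%fset).
  rewrite lead_coefE (dual_size_odd YS hnY hdY cY hparY).
  by apply: mulr_gt0; exact: funk_gt0.
have reprY x : x \in X -> half_repr x \in Y.
  move=> xX; rewrite !inE /=; case: (half_reprP x) => e; first by rewrite !e xX eqxx.
  by rewrite e half_reprN e XN // eqxx.
exists (fun i => W (half_repr (val i)) / 2); split => [i|].
  by apply: divr_gt0 => //; apply/Wpos/reprY; exact: valP.
apply: design_of_top_degrees => [i|f fn]; first by apply: XS; exact: valP.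
rewrite -(big_seq_fsetE _ X xpredT (fun x => W (half_repr x) / 2 * f.@[x ord0])) /=.
rewrite (half_sum XS XN).
have evN k x : f \is k.-homog -> f.@[(- x) ord0] = (-1) ^+ k * f.@[x ord0].
  by move=> fk; rewrite -scaleN1r (homog_evZ _ _ fk).
case: fn => fn.
  rewrite (mean_odd HJ _ fn) ?big1 //=; last by rewrite oddM.
  by move=> x _; rewrite half_reprN (evN _ _ fn) exprS exprM sqrrN !expr1n; ring.
have fnn : f \is (n + n).-homog by rewrite addnn -mul2n.
rewrite (@quadrature_of_interpolation R p J HJ Y val (fun i => h (val i)) n n _ hnY _ f fnn) //.
  rewrite [RHS]big_fset_condE -/Y big_seq_fsetE; apply: eq_bigr => i _ /=.
  have [_ ri] := inY i; rewrite half_reprN ri (evN _ _ fnn) addnn -mul2n exprM sqrrN.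
  by rewrite !expr1n mul1r /W; field.
move=> g y gn yS; exact: (interpolation_odd YS hnY hdY cY hparY).
Qed.

Section Converse.
Variables (I : finType) (w : I -> R) (pt : I -> 'rV[R]_d).
Hypotheses (ptS : forall i, onS (pt i)) (w_gt0 : forall i, 0 < w i)
  (w_sum : \sum_i w i = 1).

(** A nonnegative zonal function with mean zero vanishes on the sphere. *)
Lemma design_nonneg_eq0 t q x : design J t w pt -> (size q <= t.+1)%N -> onS x ->
  (forall s, -1 <= s <= 1 -> 0 <= q.[s]) ->
  (forall i, q.[dot x (pt i)] = 0) -> q = 0.
Proof.
move=> HD qt xS q_ge0 q0; apply: (zonal_eq0 xS) => y yS.
have Jq : J (zon q x) = 0.
  by rewrite (design_zonal _ HD qt) big1 // => i _; rewrite q0 mulr0.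
rewrite -zon_ev; apply: (mean_ge0_eq0 HJ) Jq y yS => z zS.
by rewrite zon_ev q_ge0 // dot_unit_itv.
Qed.

(** In Q = G + G' the two kernels have opposite parities, so the cross term of
    Q(x.-)^2 has mean zero and the mean of the square is Q(1), the number of
    nodes. *)
Theorem tight_even_kernel n : design J (2 * n.+1) w pt ->
  #|I| = ('C(p.+1 + n.+1, n.+1) + 'C(p.+1 + n, n))%N ->
  exists Q : {poly R}, [/\ (size Q <= n.+2)%N, Q.[1] != 0 &
    forall i j, i != j -> Q.[dot (pt i) (pt j)] = 0].
Proof.
move=> HD cI; have [G [K [Gs Kh KG Krep G1]]] := exists_zonal_kernel HJ n.+1.
have [G' [K' [Gs' Kh' KG' Krep' G1']]] := exists_zonal_kernel HJ n.
pose Q := G + G'; pose N : R := #|I|%:R.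
have Q1 : Q.[1] = N by rewrite hornerD G1 G1' -natrD -cI.
have mean_Q i : \sum_j w j * Q.[dot (pt i) (pt j)] ^+ 2 = N.
  set x := pt i; have xS : onS x := ptS i.
  have sK : (msize (K x * K x) <= (2 * n.+1).+1)%N.
    by rewrite mul2n -addnn; apply: msize_homog; apply: dhomogM.
  have sKK' : (msize (K x * K' x) <= (2 * n.+1).+1)%N.
    by apply: leq_trans (msize_homog (dhomogM (Kh x) (Kh' x))) _; lia.
  have sK' : (msize (K' x * K' x) <= (2 * n.+1).+1)%N.
    by apply: leq_trans (msize_homog (dhomogM (Kh' x) (Kh' x))) _; lia.
  have JK : J (K x * K x) = G.[1] by rewrite Krep // KG // xS.
  have JK' : J (K' x * K' x) = G'.[1] by rewrite Krep' // KG' // xS.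
  have JKK' : J (K x * K' x) = 0.
    by apply: (mean_odd HJ) (dhomogM (Kh x) (Kh' x)); rewrite addSn /= oddD addbb.
  have -> : N = J (K x * K x) + J (K' x * K' x) + 2 * J (K x * K' x).
    by rewrite JK JK' JKK' mulr0 addr0 -Q1 hornerD.
  rewrite (HD _ sK) (HD _ sK') (HD _ sKK') mulr_sumr -big_split -big_split /=.
  apply: eq_bigr => j _.
  by rewrite !mevalM KG // KG' // /Q hornerD; ring.
exists Q; split.
- by rewrite (leq_trans (size_polyD _ _)) // geq_max Gs (leq_trans Gs').
- rewrite Q1 pnatr_eq0 cI addn_eq0 negb_and; apply/orP; left.
  by rewrite -lt0n bin_gt0 leq_addl.
move=> i j ij; apply/eqP; rewrite -sqrf_eq0; apply/eqP.
pose phi i j := Q.[dot (pt i) (pt j)] ^+ 2.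
have phi_ge0 k l : 0 <= phi k l by exact: sqr_ge0.
have phi_diag k : phi k k = N ^+ 2 by rewrite /phi ptS Q1.
have [_] := tight_weights w_gt0 w_sum (erefl N) phi_ge0 phi_diag mean_Q i.
by apply; rewrite eq_sym.
Qed.

(** The factor 2 (1 + t) makes phi i i = (2 G(1))^2 the square of the number of
    nodes, G(1) being the dimension of the space of homogeneous polynomials; the
    term with t is odd and has mean zero. *)
Theorem tight_odd_kernel n : design J (2 * n).+1 w pt ->
  #|I| = (2 * 'C(p.+1 + n, n))%N ->
  (forall i, exists j, pt j = - pt i) /\
  exists Q : {poly R}, [/\ (size Q <= n.+2)%N, Q.[1] != 0 &
    forall i j, i != j -> Q.[dot (pt i) (pt j)] = 0].
Proof.
move=> HD cI; have [G [K [Gs Kh KG Krep G1]]] := exists_zonal_kernel HJ n.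
pose N : R := #|I|%:R.
have G1N : 2 * G.[1] = N by rewrite G1 -natrM -cI.
have G1_neq0 : G.[1] != 0 by rewrite G1 pnatr_eq0 -lt0n bin_gt0 leq_addl.
have KKh x : K x * K x \is (n + n).-homog by apply: dhomogM.
have JK i : J (K (pt i) * K (pt i)) = G.[1] by rewrite Krep // KG // ptS.
have mean_G i : \sum_j w j * G.[dot (pt i) (pt j)] ^+ 2 = G.[1].
  rewrite -(JK i) HD; last by apply: leq_trans (msize_homog (KKh _)) _; lia.
  by apply: eq_bigr => j _; rewrite mevalM KG // expr2.
have mean_tG i : \sum_j w j * (dot (pt i) (pt j) * G.[dot (pt i) (pt j)] ^+ 2) = 0.
  have lKh : lin (pt i) * (K (pt i) * K (pt i)) \is (1 + (n + n)).-homog.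
    by apply: dhomogM => //; exact: lin_homog.
  rewrite -[RHS](mean_odd HJ _ lKh) ?oddD ?addbb //.
  rewrite HD; last by apply: leq_trans (msize_homog lKh) _; lia.
  by apply: eq_bigr => j _; rewrite !mevalM lin_ev KG // expr2.
pose phi i j := 2 * (1 + dot (pt i) (pt j)) * G.[dot (pt i) (pt j)] ^+ 2.
have phi_ge0 i j : 0 <= phi i j.
  have /andP[lo _] := dot_unit_itv (ptS i) (ptS j).
  by rewrite mulr_ge0 ?sqr_ge0 // mulr_ge0 //; lra.
have phi_diag i : phi i i = N ^+ 2 by rewrite /phi ptS -G1N; ring.
have phi_mean i : \sum_j w j * phi i j = N.
  have <- : 2 * (\sum_j w j * G.[dot (pt i) (pt j)] ^+ 2 +
      \sum_j w j * (dot (pt i) (pt j) * G.[dot (pt i) (pt j)] ^+ 2)) = N.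
    by rewrite mean_G mean_tG addr0.
  rewrite -big_split mulr_sumr.
  by apply: eq_bigr => j _; rewrite /phi /=; ring.
have [wN phi0] : (forall i, w i = N^-1) /\ (forall i j, i != j -> phi i j = 0).
  have tw := tight_weights w_gt0 w_sum (erefl N) phi_ge0 phi_diag phi_mean.
  split=> [i|i j ij]; have [wi h] := tw i => //.
  by apply: h; rewrite eq_sym.
have G0 i j : i != j -> dot (pt i) (pt j) = -1 \/ G.[dot (pt i) (pt j)] = 0.
  move=> /phi0/eqP; rewrite /phi !mulf_eq0 pnatr_eq0 orbb /= => /orP[] /eqP e; [left|by right].
  by lra.
have antip i j : dot (pt i) (pt j) = -1 -> pt j = - pt i.
  move=> ij; apply/eqP; rewrite -subr_eq0 opprK -dot_eq0 !dotE ptS ptS dotC ij; apply/eqP; ring.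
split=> [i|].
  (* If -x were missing, the term j = i of mean_G would stand alone, and it
     equals G(1) / 2. *)
  case: (pickP (fun j => pt j == - pt i)) => [j /eqP|noN]; [by exists j|exfalso].
  have := mean_G i; rewrite (bigD1 i) //= ptS wN big1 ?addr0 => [|j ji].
    rewrite -G1N => e; suff /eqP : G.[1] = 0 by rewrite (negPf G1_neq0).
    have : (2 * G.[1])^-1 * G.[1] ^+ 2 = G.[1] / 2 by field.
    by rewrite e => ?; lra.
  have [|/antip ij|->] := @G0 i j; first by rewrite eq_sym.
    by have := noN j; rewrite ij eqxx.
  by rewrite expr0n mulr0.
exists (G * ('X + 1%:P)); split.
- by apply: (leq_trans (size_polyMleq _ _)); rewrite size_XaddC addn2 /= ltnS.
- by rewrite !hornerE mulf_neq0 // lt0r_neq0 // addr_gt0.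
- move=> i j /G0[]; rewrite !hornerE => ->; first by rewrite addNr mulr0.
  by rewrite mul0r.
Qed.

End Converse.

End DesignsOnSphere.

(** * The mean determined by a family of moments *)

Section FromMoments.
Variables (R : rcfType) (d : nat) (S : ('rV[R]_d -> R) -> R) (mu : 'X_{1..d} -> R).
Let poly (s : seq 'X_{1..d}) (c : 'X_{1..d} -> R) (x : 'rV[R]_d) : R :=
  \sum_(m <- s) c m * \prod_i x ord0 i ^+ m i.
Hypotheses (S_ext : forall F G, (forall x, onS x -> F x = G x) -> S F = S G)
  (S_poly : forall s c, S (poly s c) = \sum_(m <- s) c m * mu m)
  (S_gt0 : forall s c x0, (forall x, onS x -> 0 <= poly s c x) -> onS x0 ->
     0 < poly s c x0 -> 0 < S (poly s c))
  (S1_gt0 : 0 < S (fun=> 1))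
  (mu_U1 : forall (m : 'X_{1..d}) i, m i = 1%N -> mu m = 0)
  (mu_U2 : forall (m : 'X_{1..d}) i, (mdeg m + d)%:R * mu (m + U_(i) *+ 2)%MM = (m i).+1%:R * mu m).

Definition normalized_mean (f : {mpoly R[d]}) : R :=
  (S (fun=> 1))^-1 * S (fun x => f.@[x ord0]).

Let S_mpoly (f : {mpoly R[d]}) k : (msize f <= k)%N ->
  S (fun x => f.@[x ord0]) = \sum_(m : 'X_{1..d < k}) f@_m * mu m.
Proof.
move=> fk; pose s := [seq val m | m : 'X_{1..d < k} <- index_enum _].
transitivity (S (poly s (fun m => f@_m))); last by rewrite S_poly big_map.
apply: S_ext => x _; rewrite /poly big_map {1}(mpolywE fk) raddf_sum.
by apply: eq_bigr => m _ /=; rewrite mevalZ mevalX.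
Qed.

Lemma normalized_mean_scalar : scalar normalized_mean.
Proof.
move=> c f g; rewrite /normalized_mean.
pose k := maxn (msize (c *: f + g)) (maxn (msize f) (msize g)).
rewrite !(@S_mpoly _ k) /k ?leq_max ?leqnn ?orbT //.
rewrite mulrCA -mulrDr; congr (_ * _); rewrite mulr_sumr -big_split /=.
by apply: eq_bigr => m _; rewrite mcoeffD mcoeffZ mulrDl mulrA.
Qed.

(** Abstracts the surface integral to a functional S that acts on finite sums of
    monomials through its moments mu. *)
Theorem sphere_mean_of_moments :
  exists2 J : {scalar {mpoly R[d]}}, J =1 normalized_mean & sphere_mean J.
Proof.
pose J : {scalar {mpoly R[d]}} := HB.pack normalized_mean
  (GRing.isLinear.Build R {mpoly R[d]} R *%R normalized_mean normalized_mean_scalar).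
have JX m : J 'X_[m] = (S (fun=> 1))^-1 * mu m.
  congr (_ * _); transitivity (S (poly [:: m] (fun=> 1))).
    by apply: S_ext => x _; rewrite /poly big_seq1 mul1r mevalX.
  by rewrite S_poly big_seq1 mul1r.
exists J => //; split.
- rewrite /J /= /normalized_mean (S_ext (G := fun=> 1)) => [|x _]; last exact: meval1.
  by rewrite mulVf // gt_eqF.
- by move=> m i mi; rewrite JX (mu_U1 mi) mulr0.
- by move=> m i; rewrite !JX mulrCA mu_U2 mulrCA.
- by move=> f g fg; congr (_ * _); apply: S_ext.
move=> f f_ge0 Jf x xS; apply/eqP; rewrite eq_le f_ge0 // andbT leNgt.
apply/negP => fx; pose P := poly (msupp f) (fun m => f@_m).
have PE y : P y = f.@[y ord0] by rewrite mevalE.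
have : 0 < J f; last by rewrite Jf ltxx.
apply: mulr_gt0; first by rewrite invr_gt0.
rewrite (S_ext (G := P)) => [|y _]; last by rewrite PE.
by apply: (S_gt0 (x0 := x)) => // [y yS|]; rewrite -/P PE // f_ge0.
Qed.

End FromMoments.

End SpherePolynomials.

From mathcomp Require Import all_classical all_reals all_analysis measurable_realfun.
Import Order.TTheory GRing.Theory Num.Theory.
Import numFieldNormedType.Exports.
Import -(notations) mpoly.
Import SpherePolynomials.

(** * Wallis integrals *)

Section Wallis.
Local Open Scope classical_set_scope.
Local Open Scope ring_scope.
Variable R : realType.
Implicit Types (a b : nat) (f : R -> R).

Notation I0pi := (`[(0:R), pi]%classic).
Notation Int f := (\int[@lebesgue_measure R]_(t in `[(0:R), pi]) f t).

Lemma integrable_0pi f : continuous f ->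
  (@lebesgue_measure R).-integrable I0pi (EFin \o f).
Proof.
move=> cf; apply: continuous_compact_integrable; first exact: segment_compact.
exact: continuous_subspaceT.
Qed.

Lemma continuous_sumf (I : Type) (s : seq I) (F : I -> R -> R) :
  (forall i, continuous (F i)) -> continuous (fun t => \sum_(i <- s) F i t).
Proof.
move=> cF; elim: s => [|i s IHs].
  under [X in continuous X]funext => t do rewrite big_nil.
  exact: cst_continuous.
under [X in continuous X]funext => t do rewrite big_cons.
by move=> t; apply: (@cvgD _ _ _ (nbhs t)); [exact: cF|exact: IHs].
Qed.

Lemma continuous_cosXsinX a b : continuous (fun t : R => cos t ^+ a * sin t ^+ b).
Proof.
move=> t; apply: (@cvgM _ _ (nbhs t)).
  exact: continuous_comp (@continuous_cos R t) (@exprn_continuous R a _).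
exact: continuous_comp (@continuous_sin R t) (@exprn_continuous R b _).
Qed.

Lemma continuous_mull c f : continuous f -> continuous (fun t : R => c * f t).
Proof.
by move=> cf t; apply: (@cvgM _ _ (nbhs t)); [exact: cvg_cst|exact: cf].
Qed.

Lemma int_0pi_sum (I : Type) (s : seq I) (F : I -> R -> R) :
  (forall i, continuous (F i)) ->
  Int (fun t => \sum_(i <- s) F i t) = \sum_(i <- s) Int (F i).
Proof.
move=> cF; elim: s => [|i s IHs].
  rewrite big_nil; under eq_Rintegral do rewrite big_nil.
  by rewrite Rintegral_cst// mul0r.
rewrite big_cons -IHs; under eq_Rintegral do rewrite big_cons.
apply: RintegralD => //; apply: integrable_0pi; first exact: cF.
exact: continuous_sumf.
Qed.

Definition wallis a b : R := Int (fun t => cos t ^+ a * sin t ^+ b).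

Lemma int_0pi_derive (F f : R -> R) : continuous f ->
  (forall t : R, is_derive t 1 F (f t)) -> Int f = F pi - F 0.
Proof.
move=> cf dF.
have pi0 : (0 : R) < pi by exact: pi_gt0.
have cF : continuous F.
  move=> t; apply: differentiable_continuous; apply/derivable1_diffP.
  by have [] := dF t.
rewrite /Rintegral (@continuous_FTC2 R f F 0 pi pi0) //.
- exact: continuous_subspaceT.
- split.
  + by move=> t _; have [] := dF t.
  + exact/cvg_at_right_filter/cF.
  + exact/cvg_at_left_filter/cF.
- by move=> t _; rewrite derive1E; have [_ ->] := dF t.
Qed.

(** The integral of the derivative of cos^a sin^(b+1). *)
Lemma wallis_parts a b :
  b.+1%:R * wallis a.+1 b = a%:R * wallis a.-1 b.+2.
Proof.
have cW := continuous_cosXsinX.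
apply/eqP; rewrite -subr_eq0; apply/eqP.
rewrite /wallis -!RintegralZl //; try exact/integrable_0pi/cW.
rewrite -RintegralB //; try exact/integrable_0pi/continuous_mull/cW.
pose F (t : R) : R := cos t ^+ a * sin t ^+ b.+1.
have dF (t : R) : is_derive t 1 F
    (b.+1%:R * (cos t ^+ a.+1 * sin t ^+ b) -
     a%:R * (cos t ^+ a.-1 * sin t ^+ b.+2)).
  have := is_deriveM (is_deriveX a (is_derive_cos t)) (is_deriveX b.+1 (is_derive_sin t)).
  have -> : F = cos ^+ a * sin ^+ b.+1 by apply/funext => u; rewrite /F /= !fctE.
  move=> h; apply: (is_derive_eq h); rewrite !fctE /GRing.scale /= !exprS.
  by case: a {F h} => [|a]; rewrite ?exprS /=; ring.
rewrite (int_0pi_derive _ dF); first by rewrite /F sinpi sin0 !expr0n !mulr0 subr0.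
by move=> t; apply: (@cvgB _ _ _ (nbhs t)); exact: continuous_mull (cW _ _) t.
Qed.

Lemma wallis_cos1 b : wallis 1 b = 0.
Proof.
have /eqP := wallis_parts 0 b; rewrite mul0r mulf_eq0 pnatr_eq0 /=.
by move/eqP.
Qed.

Lemma wallis_split a b : wallis a b = wallis a.+2 b + wallis a b.+2.
Proof.
have cW := continuous_cosXsinX.
rewrite /wallis -RintegralD //; try exact/integrable_0pi/cW.
apply: eq_Rintegral => t _; rewrite !exprS.
have := cos2Dsin2 t; rewrite !expr2 => E.
transitivity (cos t ^+ a * sin t ^+ b * (cos t * cos t + sin t * sin t)).
  by rewrite E mulr1.
ring.
Qed.

Lemma wallis_cosSS a b :
  (a + b + 2)%:R * wallis a.+2 b = a.+1%:R * wallis a b.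
Proof.
have := wallis_parts a.+1 b; have := wallis_split a b => /= -> E.
rewrite mulrDr -E -mulrDl -natrD; congr (_%:R * _); lia.
Qed.

Lemma wallis_sinSS a b :
  (a + b + 2)%:R * wallis a b.+2 = b.+1%:R * wallis a b.
Proof.
have := wallis_parts a.+1 b; have := wallis_split a b => /= -> E.
rewrite mulrDr E -mulrDl -natrD; congr (_%:R * _); lia.
Qed.

(** The integrand stays above f(c)/2 on a small segment around c. *)
Lemma int_0pi_gt0 f c : continuous f -> (forall t, 0 <= t <= pi -> 0 <= f t) ->
  0 < c < pi -> 0 < f c -> 0 < Int f.
Proof.
move=> cf f_ge0 /andP[c0 cpi] fc_gt0.
have fc2 : f c / 2 < f c by lra.
have /nbhs_ballP[e /= e0 he] : \forall t \near c, f c / 2 < f t.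
  exact: (cvgr_gt (f c) (cf c)).
pose r := Num.min (e / 2) (Num.min c (pi - c)).
have re : r <= e / 2 by rewrite /r ge_min lexx.
have rc : r <= c by rewrite /r !ge_min lexx orbT.
have rpi : r <= pi - c by rewrite /r !ge_min lexx !orbT.
have r0 : 0 < r by rewrite /r !lt_min; apply/and3P; split; lra.
pose J := `[c - r, c + r]%classic.
have sub : J `<=` I0pi.
  move=> t /=; rewrite !in_itv /= => /andP[]; rewrite !bnd_simp => t1 t2.
  by apply/andP; split; lra.
have mf (A : set (measurableTypeR R)) : measurable_fun A f.
  by apply: measurable_funTS; exact: continuous_measurable_fun.
have itg := integrable_0pi cf.
rewrite /Rintegral -lte_fin fineK; last exact: integrable_fin_num.
apply: (@lt_le_trans _ _ (\int[@lebesgue_measure R]_(t in J) (f c / 2)%:E)%E).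
  rewrite /J integral_cst //= lebesgue_measure_itv /= lte_fin ifT; last by lra.
  rewrite -EFinD -EFinM lte_fin; nra.
apply: (@le_trans _ _ (\int[@lebesgue_measure R]_(t in J) (f t)%:E)%E).
  apply: ge0_le_integral => //.
  - exact: measurable_itv.
  - by move=> t _; rewrite lee_fin; lra.
  - by apply/measurable_EFinP; exact: mf.
  - move=> t /=; rewrite /J /= in_itv /= lee_fin => /andP[t1 t2]; apply/ltW/he.
    by rewrite /ball /= ltr_norml; apply/andP; split; lra.
apply: ge0_subset_integral => //; first exact: measurable_itv.
  by apply/measurable_EFinP; exact: mf.
Qed.

End Wallis.

(** * The integral of a polynomial over the sphere *)

Section SphereMoments.
Local Open Scope classical_set_scope.
Local Open Scope ring_scope.
Variable R : realType.

(** The integral of the monomial with exponents e, following the recursion in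
    spherical coordinates: the latitude contributes a Wallis integral, in which
    the sines come from the surface element and from all the other coordinates. *)
Fixpoint sphere_moment (d : nat) : ('I_d -> nat) -> R :=
  match d return ('I_d -> nat) -> R with
  | 0 => fun=> 0
  | d'.+1 =>
    match d' return (('I_d' -> nat) -> R) -> ('I_d'.+1 -> nat) -> R with
    | 0 => fun _ e => 1 + (- 1) ^+ e ord0
    | m.+1 => fun M e =>
        let e' i := e (lift ord0 i) in
        wallis R (e ord0) (m + \sum_i e' i) * M e'
    end (@sphere_moment d')
  end.

Lemma sphere_momentSS m (e : 'I_m.+2 -> nat) :
  sphere_moment e = wallis R (e ord0) (m + \sum_i e (lift ord0 i)) *
    sphere_moment (fun i => e (lift ord0 i)).
Proof. by []. Qed.

Lemma onSE d (x : 'rV[R]_d) : onS x = (\sum_i x ord0 i ^+ 2 = 1).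
Proof. by rewrite /onS /dot; under eq_bigr do rewrite -expr2. Qed.

Definition polar m (t : R) (u : 'rV[R]_m.+1) : 'rV[R]_m.+2 :=
  row_mx (cos t)%:M (sin t *: u).

Lemma polar0 m t u : @polar m t u ord0 ord0 = cos t.
Proof.
transitivity (row_mx (cos t)%:M (sin t *: u) ord0 (lshift m.+1 (ord0 : 'I_1))).
  by congr (fun_of_matrix _ _ _); exact/val_inj.
by rewrite row_mxEl mxE.
Qed.

Lemma polarS m t u i : @polar m t u ord0 (lift ord0 i) = sin t * u ord0 i.
Proof.
transitivity (row_mx (cos t)%:M (sin t *: u) ord0 (rshift 1 i)).
  by congr (fun_of_matrix _ _ _); exact/val_inj.
by rewrite row_mxEr mxE.
Qed.

Lemma onS_polar m t u : onS u -> onS (@polar m t u).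
Proof.
rewrite !onSE => uS; rewrite big_ord_recl polar0; under eq_bigr do rewrite polarS exprMn.
by rewrite -mulr_sumr uS mulr1 cos2Dsin2.
Qed.

Lemma sphere_integralSS m (f : 'rV[R]_m.+2 -> R) :
  sphere_integral f = \int[@lebesgue_measure R]_(t in `[0, pi]%classic)
    (sin t ^+ m * sphere_integral (fun u => f (polar t u))).
Proof. by []. Qed.

Lemma onS1 (x : 'rV[R]_1) : onS x -> x = const_mx 1 \/ x = const_mx (- 1).
Proof.
rewrite !onSE big_ord1 => /eqP; rewrite sqrf_eq1 => /orP[] /eqP xE; [left|right];
  by apply/rowP => i; rewrite ord1 mxE xE.
Qed.

Lemma onS1_const (c : R) : c ^+ 2 = 1 -> onS (const_mx c : 'rV[R]_1).
Proof. by move=> c1; rewrite !onSE big_ord1 mxE. Qed.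

Lemma eq_sphere_integral d (f g : 'rV[R]_d -> R) :
  (forall x, onS x -> f x = g x) -> sphere_integral f = sphere_integral g.
Proof.
elim: d f g => [//|[_ f g fg|m IHd f g fg]].
  by congr (_ + _); apply: fg; apply: onS1_const; rewrite ?sqrrN expr1n.
rewrite !sphere_integralSS; apply: eq_Rintegral => t _; congr (_ * _).
by apply: IHd => u uS; apply/fg/onS_polar.
Qed.

Lemma sphere_integral_ge0 d (f : 'rV[R]_d -> R) :
  (forall x, onS x -> 0 <= f x) -> 0 <= sphere_integral f.
Proof.
elim: d f => [//|[_ f f0|m IHd f f0]].
  by apply: addr_ge0; apply: f0; apply: onS1_const; rewrite ?sqrrN expr1n.
rewrite sphere_integralSS; apply: Rintegral_ge0 => t /=.
rewrite in_itv /= => /andP[t0 tpi]; apply: mulr_ge0.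
  by rewrite exprn_ge0 // sin_ge0_pi // t0.
by apply: IHd => u uS; apply/f0/onS_polar.
Qed.

Definition polyfun d (I : Type) (s : seq I) (c : I -> R) (e : I -> 'I_d -> nat)
  (x : 'rV[R]_d) : R := \sum_(i <- s) c i * \prod_j x ord0 j ^+ e i j.

Lemma polyfun_polar m (I : Type) (s : seq I) c (e : I -> 'I_m.+2 -> nat) t u :
  polyfun s c e (polar t u) =
  polyfun s (fun i => c i * (cos t ^+ e i ord0 * sin t ^+ \sum_j e i (lift ord0 j)))
    (fun i j => e i (lift ord0 j)) u.
Proof.
apply: eq_bigr => i _; rewrite -!mulrA big_ord_recl polar0; congr (_ * (_ * _)).
rewrite -prodrXr -big_split /=; apply: eq_bigr => j _.
by rewrite polarS exprMn.
Qed.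

(** Linearity of the surface integral is proved together with its values, since
    at each step of the recursion the inner integral is again a polynomial in
    the sine and cosine of the latitude. *)
Theorem sphere_integral_poly d (I : Type) (s : seq I) c (e : I -> 'I_d -> nat) :
  sphere_integral (polyfun s c e) = \sum_(i <- s) c i * sphere_moment (e i).
Proof.
elim: d c e => [|[_ c e|m IHd c e]].
- by move=> c e; rewrite big1 // => i _; rewrite mulr0.
- rewrite /= /polyfun -big_split /=; apply: eq_bigr => i _.
  by rewrite !big_ord1 !mxE expr1n mulrDr.
rewrite sphere_integralSS.
transitivity (\int[@lebesgue_measure R]_(t in `[0, pi]%classic)
   (\sum_(i <- s) (c i * sphere_moment (fun j => e i (lift ord0 j))) *
     (cos t ^+ e i ord0 * sin t ^+ (m + \sum_j e i (lift ord0 j))))).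
  apply: eq_Rintegral => t _.
  under [X in sphere_integral X]funext => u do rewrite polyfun_polar.
  rewrite IHd mulr_sumr; apply: eq_bigr => i _; rewrite exprD; ring.
have cW a b := @continuous_cosXsinX R a b.
rewrite int_0pi_sum => [|i]; last exact: continuous_mull (cW _ _).
apply: eq_bigr => i _; rewrite RintegralZl //; last exact: integrable_0pi (cW _ _).
by rewrite sphere_momentSS /wallis; ring.
Qed.


(** The latitude is the arc cosine of the first coordinate; at a pole u can be
    any unit vector. *)
Lemma onS_polarP m (x : 'rV[R]_m.+2) : onS x ->
  exists2 t, 0 <= t <= pi & exists2 u, onS u & x = polar t u.
Proof.
rewrite !onSE big_ord_recl; set a := x ord0 ord0; set v := \sum_i _ => xS.
have v0 : 0 <= v by apply: sumr_ge0 => i _; exact: sqr_ge0.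
have a2 : a ^+ 2 <= 1 by lra.
have aI : -1 <= a <= 1 by apply/andP; split; nra.
have st : sin (acos a) ^+ 2 = v by rewrite sin2cos2 acosK //; lra.
exists (acos a); first by rewrite acos_ge0 ?acos_lepi.
have xE (u : 'rV[R]_m.+1) : (forall i, x ord0 (lift ord0 i) = sin (acos a) * u ord0 i) ->
    x = polar (acos a) u.
  move=> h; apply/rowP => i; case: (unliftP ord0 i) => [j ->|->].
    by rewrite polarS h.
  by rewrite polar0 acosK.
have [s0|s0] := eqVneq (sin (acos a)) 0.
  exists (delta_mx ord0 ord0).
    rewrite !onSE (bigD1 ord0) //= big1 => [|i /negPf i0]; rewrite mxE ?eqxx /=.
      by rewrite expr1n addr0.
    by rewrite i0 expr0n.
  apply: xE => i; rewrite s0 mul0r; apply/eqP; rewrite -sqrf_eq0.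
  move: st; rewrite s0 expr0n /= /v => /esym/eqP.
  rewrite psumr_eq0 => [/allP|j _]; last exact: sqr_ge0.
  by move=> /(_ i); rewrite mem_index_enum; apply.
exists (\row_i (x ord0 (lift ord0 i) / sin (acos a))).
  rewrite !onSE; under eq_bigr do rewrite mxE exprMn.
  by rewrite -mulr_suml -/v -st exprVn divff // sqrf_eq0.
by apply: xE => i; rewrite mxE mulrC divfK.
Qed.

(** The inner integral J is a nonnegative continuous function of the latitude,
    positive at the latitude of x0. That one may be a pole, where the surface
    element vanishes, so a nearby latitude c0 inside the interval is used. *)
Lemma sphere_integral_gt0 d (I : Type) (s : seq I) c (e : I -> 'I_d -> nat) x0 :
  (forall x, onS x -> 0 <= polyfun s c e x) -> onS x0 -> 0 < polyfun s c e x0 ->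
  0 < sphere_integral (polyfun s c e).
Proof.
elim: d c e x0 => [|[_ c e x0|m IHd c e x0]].
- by move=> c e x0 _; rewrite !onSE big_ord0 => /esym/eqP; rewrite oner_eq0.
- set F := polyfun s c e => F0 x0S Fx0 /=.
  have F1 : 0 <= F (const_mx 1) by apply/F0/onS1_const; rewrite expr1n.
  have FN1 : 0 <= F (const_mx (- 1)) by apply/F0/onS1_const; rewrite sqrrN expr1n.
  by move: Fx0; case: (onS1 x0S) => ->; lra.
move=> F0 /onS_polarP[t0 t0I [u0 u0S ->]] Fx0.
rewrite sphere_integralSS.
pose J t := \sum_(i <- s) (c i * sphere_moment (fun j => e i (lift ord0 j))) *
     (cos t ^+ e i ord0 * sin t ^+ (\sum_j e i (lift ord0 j))).
have cJ : continuous J.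
  by apply: continuous_sumf => i; exact: continuous_mull (@continuous_cosXsinX R _ _).
have JE t : sphere_integral (fun u => polyfun s c e (polar t u)) = J t.
  under [X in sphere_integral X]funext => u do rewrite polyfun_polar.
  by rewrite sphere_integral_poly; apply: eq_bigr => i _; ring.
have J0 t : 0 <= J t.
  by rewrite -JE; apply: sphere_integral_ge0 => u uS; apply/F0/onS_polar.
have Jt0 : 0 < J t0.
  rewrite -JE; under [X in sphere_integral X]funext => u do rewrite polyfun_polar.
  by apply: IHd u0S _ => [u uS|]; rewrite -polyfun_polar //; apply/F0/onS_polar.
have pi0 : (0 : R) < pi := pi_gt0 R.
have [c0 c0I Jc0] : exists2 c0, 0 < c0 < pi & 0 < J c0.
  have /nbhs_ballP[r /= r0 hr] : \forall t \near t0, 0 < J t.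
    exact: (cvgr_gt (J t0) (cJ t0)).
  pose q := Num.min (1 / 2) (r / (pi + pi)).
  have q1 : q <= 1 / 2 by rewrite /q ge_min lexx.
  have q2 : q * (pi + pi) <= r.
    by rewrite -ler_pdivlMr; [rewrite /q ge_min lexx orbT|lra].
  have q0 : 0 < q by rewrite /q lt_min; apply/andP; split; [lra|apply: divr_gt0; lra].
  move/andP: t0I => [t1 t2].
  exists (t0 + q * (pi / 2 - t0)); first by apply/andP; split; nra.
  by apply: hr; rewrite /ball /= ltr_norml; apply/andP; split; nra.
under eq_Rintegral do rewrite JE.
apply: (@int_0pi_gt0 R _ c0) => //.
- move=> t; apply: (@cvgM _ _ (nbhs t)); last exact: cJ.
  exact: continuous_comp (@continuous_sin R t) (@exprn_continuous R m _).
- move=> t tI; rewrite mulr_ge0 // exprn_ge0 // sin_ge0_pi //.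
- by rewrite mulr_gt0 // exprn_gt0 // sin_gt0_pi.
Qed.


Lemma eq_sphere_moment d (e e' : 'I_d -> nat) :
  e =1 e' -> sphere_moment e = sphere_moment e'.
Proof. by move=> ee'; congr sphere_moment; apply/funext. Qed.

Lemma sphere_moment1 d (e : 'I_d -> nat) i : e i = 1%N -> sphere_moment e = 0.
Proof.
elim: d e i => [_ []//|[_ e i|m IHd e i ei]].
  by rewrite ord1 /= => ->; rewrite expr1 subrr.
rewrite sphere_momentSS; case: (unliftP ord0 i) ei => [j ->|->] ei.
  by rewrite (IHd _ j) ?mulr0.
by rewrite ei wallis_cos1 mul0r.
Qed.

(** The factor gained by the Wallis integral of the latitude depends on whether
    the exponent raised by two belongs to the first coordinate or to another
    one. *)
Lemma sphere_momentD2 d (e e' : 'I_d.+1 -> nat) i :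
  (forall j, e' j = e j + 2 * (j == i))%N ->
  ((\sum_j e j) + d.+1)%:R * sphere_moment e' = (e i).+1%:R * sphere_moment e.
Proof.
elim: d e e' i => [|m IHd] e e' i e'E.
  by rewrite big_ord1 addn1 /= e'E !ord1 eqxx exprD sqrrN expr1n mulr1.
rewrite !sphere_momentSS big_ord_recl.
have split_e' : (forall j, e' (lift ord0 j) = e (lift ord0 j) +
   2 * (lift ord0 j == i))%N by move=> j; rewrite e'E.
have e'0 : (e' ord0 = e ord0 + 2 * (ord0 == i))%N by rewrite e'E.
set s := (\sum_j e (lift ord0 j))%N.
case: (unliftP ord0 i) e'0 split_e' => [k ->|->] e'0 split_e'.
  have {}e'0 : e' ord0 = e ord0 by rewrite e'0 (negPf (neq_lift _ _)) muln0 addn0.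
  have {}split_e' j : (e' (lift ord0 j) = e (lift ord0 j) + 2 * (j == k))%N.
    by rewrite split_e' (inj_eq lift_inj).
  have s' : (\sum_j e' (lift ord0 j) = s + 2)%N.
    rewrite (eq_bigr (fun j => e (lift ord0 j) + 2 * (j == k)))%N => [|j _];
      last exact: split_e'.
    rewrite big_split -big_distrr /= (_ : \sum_j (j == k) = 1)%N // (bigD1 k) //=.
    by rewrite eqxx big1 // => j /negPf ->.
  have := IHd _ _ k split_e'; rewrite -/s => IH.
  have := wallis_sinSS R (e ord0) (m + s).
  rewrite e'0 s' (_ : m + (s + 2) = (m + s).+2)%N; last by lia.
  rewrite (_ : e ord0 + s + m.+2 = e ord0 + (m + s) + 2)%N; last by lia.
  rewrite (_ : s + m.+1 = (m + s).+1)%N in IH; last by lia.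
  move=> W; rewrite mulrA W mulrAC IH; ring.
have {}split_e' j : e' (lift ord0 j) = e (lift ord0 j).
  by rewrite split_e' eq_sym (negPf (neq_lift _ _)) muln0 addn0.
rewrite (eq_sphere_moment split_e') (eq_bigr _ (fun j _ => split_e' j)) -/s.
rewrite e'0 eqxx muln1 addn2 !mulrA -wallis_cosSS; congr (_%:R * _ * _); lia.
Qed.

Lemma sphere_area_gt0 d : 0 < sphere_area R d.+1.
Proof.
pose one := polyfun [:: tt] (fun=> 1) (fun _ (j : 'I_d.+1) => 0%N).
have oneE x : one x = 1.
  by rewrite /one /polyfun big_seq1 big1 ?mul1r // => j _; rewrite expr0.
have -> : sphere_area R d.+1 = sphere_integral one.
  by apply: eq_sphere_integral => x _; rewrite oneE.
apply: (@sphere_integral_gt0 _ _ _ _ _ (delta_mx ord0 ord0)) => [x _||].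
- by rewrite -/one oneE.
- rewrite !onSE (bigD1 ord0) //= big1 => [|i /negPf i0]; rewrite mxE ?eqxx /=.
    by rewrite expr1n addr0.
  by rewrite i0 expr0n.
- by rewrite -/one oneE.
Qed.

End SphereMoments.

Local Open Scope fset_scope.
Local Open Scope ring_scope.

(** * The normalised surface integral *)

Section SphereMean.
Variables (R : realType) (d : nat).

Definition sphere_avg (f : mpoly.mpoly d R) : R :=
  (sphere_area R d)^-1 * sphere_integral (fun x : 'rV[R]_d => mpoly.meval (x ord0) f).

End SphereMean.

(** The link between the surface integral and the axioms of [sphere_mean]. *)
Lemma sphere_avg_mean (R : realType) d :
  exists2 J : {scalar (mpoly.mpoly d.+1 R)}, J =1 @sphere_avg R d.+1 & sphere_mean J.
Proof.
have [] := @sphere_mean_of_moments R d.+1 (@sphere_integral R d.+1)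
  (fun m => sphere_moment R (fun i => m i)).
- by move=> F G; exact: eq_sphere_integral.
- by move=> s c; exact: (sphere_integral_poly s c (fun m (i : 'I_d.+1) => m i)).
- move=> s c x0 ge0 x0S gt0.
  exact: (@sphere_integral_gt0 R d.+1 _ s c (fun m (i : 'I_d.+1) => m i) x0).
- exact: sphere_area_gt0.
- by move=> m i mi; exact: sphere_moment1 mi.
- move=> m i; rewrite mpoly.mdegE; apply: sphere_momentD2 => j.
  rewrite mpoly.mnmDE mpoly.mulmnE mpoly.mnm1E (eq_sym j); lia.
by move=> J JE HJ; exists J.
Qed.

(** * Distances and inner products *)

Section Distances.
Variables (R : realType) (d : nat).
Implicit Types (X : {fset 'rV[R]_d}) (x y : 'rV[R]_d) (A : {fset R}).

Lemma on_sphereP X : on_sphere X -> forall x, x \in X -> onS x.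
Proof.
move=> XS x /XS; rewrite /eucl_norm -/(Num.sqrt _) onSE => e.
rewrite -[LHS]sqr_sqrtr ?e ?expr1n //.
by apply: sumr_ge0 => i _; rewrite sqr_ge0.
Qed.

Lemma eucl_dist_dot x y : onS x -> onS y -> eucl_dist x y = Num.sqrt (2 - 2 * dot x y).
Proof.
move=> xS yS; rewrite /eucl_dist /eucl_norm; congr Num.sqrt.
transitivity (dot (x - y) (x - y)); first by apply: eq_bigr => i _; rewrite expr2.
by rewrite !dotE xS yS (dotC y x); ring.
Qed.

Lemma dot_eucl_dist x y : onS x -> onS y -> dot x y = 1 - eucl_dist x y ^+ 2 / 2.
Proof.
move=> xS yS; have /andP[_ xy1] := dot_unit_itv xS yS.
by rewrite eucl_dist_dot // sqr_sqrtr; [field|lra].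
Qed.

Lemma dot_unit_neq1 x y : onS x -> onS y -> x != y -> dot x y != 1.
Proof.
move=> xS yS; apply: contra_neq => xy1; apply/eqP; rewrite -subr_eq0 -dot_eq0 !dotE.
by rewrite xS yS (dotC y x) xy1; apply/eqP; ring.
Qed.

Definition dots_from X x : {fset R} := [fset dot x y | y in X `\ x].

Definition dots X : {fset R} := [fset dot q.1 q.2 | q in [fset q in X `*` X | q.1 != q.2]].

(** Inner products and distances of unit vectors determine each other, so
    counting distances is counting inner products. *)
Lemma card_distances_from X x : on_sphere X -> x \in X ->
  #|` distances_from X x| = #|` dots_from X x|.
Proof.
move=> /on_sphereP XS xX; apply/eqP; rewrite eqn_leq; apply/andP; split.
  apply: (@leq_trans #|` (fun a => Num.sqrt (2 - 2 * a)) @` dots_from X x|);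
    last exact: leq_imfset_card.
  apply/fsubset_leq_card/fsubsetP => _ /imfsetP[y yX ->].
  apply/imfsetP; exists (dot x y); first by apply/imfsetP; exists y.
  by move: yX; rewrite !inE => /andP[_ yX]; rewrite eucl_dist_dot //; exact: XS.
apply: (@leq_trans #|` (fun r => 1 - r ^+ 2 / 2) @` distances_from X x|);
  last exact: leq_imfset_card.
apply/fsubset_leq_card/fsubsetP => _ /imfsetP[y yX ->].
apply/imfsetP; exists (eucl_dist x y); first by apply/imfsetP; exists y.
by move: yX; rewrite !inE => /andP[_ yX]; rewrite -dot_eucl_dist //; exact: XS.
Qed.

Lemma card_distances X : on_sphere X -> #|` distances X| = #|` dots X|.
Proof.
move=> /on_sphereP XS.
have in2 q : q \in [fset q in X `*` X | q.1 != q.2] -> onS q.1 /\ onS q.2.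
  by rewrite !inE /= => /andP[/andP[q1 q2] _]; split; exact: XS.
apply/eqP; rewrite eqn_leq; apply/andP; split.
  apply: (@leq_trans #|` (fun a => Num.sqrt (2 - 2 * a)) @` dots X|);
    last exact: leq_imfset_card.
  apply/fsubset_leq_card/fsubsetP => _ /imfsetP[q qX ->].
  apply/imfsetP; exists (dot q.1 q.2); first by apply/imfsetP; exists q.
  by have [? ?] := in2 q qX; rewrite eucl_dist_dot.
apply: (@leq_trans #|` (fun r => 1 - r ^+ 2 / 2) @` distances X|);
  last exact: leq_imfset_card.
apply/fsubset_leq_card/fsubsetP => _ /imfsetP[q qX ->].
apply/imfsetP; exists (eucl_dist q.1 q.2); first by apply/imfsetP; exists q.
by have [? ?] := in2 q qX; rewrite -dot_eucl_dist.
Qed.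

Lemma dots_fromP X x a :
  reflect (exists y, [/\ y \in X, x != y & a = dot x y]) (a \in dots_from X x).
Proof.
apply: (iffP (imfsetP _ _ _ _)) => /= [[y yX ->]|[y [yX xy ->]]].
  by exists y; move: yX; rewrite !inE eq_sym => /andP[].
by exists y => //; rewrite !inE eq_sym xy.
Qed.

Lemma dotsP X a :
  reflect (exists x y, [/\ x \in X, y \in X, x != y & a = dot x y]) (a \in dots X).
Proof.
apply: (iffP (imfsetP _ _ _ _)) => /= [[[x y] qX ->]|[x [y [xX yX xy ->]]]].
  by exists x, y; move: qX; rewrite !inE /= => /andP[/andP[]].
by exists (x, y) => //; rewrite !inE /= xX yX xy.
Qed.

(** The annihilator polynomial of a set of inner products. *)
Definition ann A : {poly R} := \prod_(a <- A) ('X - a%:P).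

Lemma ann_monic A : ann A \is monic.
Proof. exact: monic_prod_XsubC. Qed.

Lemma size_ann A : size (ann A) = #|` A|.+1.
Proof. by rewrite /ann size_prod_XsubC. Qed.

Lemma root_ann A a : a \in A -> (ann A).[a] = 0.
Proof. by move=> aA; apply/eqP; rewrite -/(root _ _) root_prod_XsubC. Qed.

Lemma ann1_gt0 A : (forall a, a \in A -> a < 1) -> 0 < (ann A).[1].
Proof.
move=> A1; rewrite horner_prod big_seq; apply: prodr_gt0 => a aA.
by rewrite !hornerE subr_gt0 A1.
Qed.

Lemma dots_from_lt1 X x a : on_sphere X -> x \in X -> a \in dots_from X x -> a < 1.
Proof.
move=> /on_sphereP XS xX /dots_fromP[y [yX xy ->]].
have /andP[_ le1] := dot_unit_itv (XS _ xX) (XS _ yX).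
by rewrite lt_neqAle le1 dot_unit_neq1 //; exact: XS.
Qed.

Lemma card_roots A (Q : {poly R}) k : (size Q <= k.+1)%N -> Q != 0 ->
  (forall a, a \in A -> Q.[a] = 0) -> (#|` A| <= k)%N.
Proof.
move=> Qk Q0 QA; rewrite -ltnS; apply: leq_trans Qk.
by apply: (max_poly_roots Q0 _ (fset_uniq A)); apply/allP => a /QA/eqP.
Qed.

(** The annihilator polynomial normalised to the value one at t = 1. *)
Definition dual_poly A : {poly R} := (ann A).[1]^-1 *: ann A.

Lemma size_dual_poly X x k : on_sphere X -> locally_distance_set k X -> x \in X ->
  (size (dual_poly (dots_from X x)) <= k.+1)%N.
Proof.
move=> XS Xk xX; apply: (leq_trans (size_scale_leq _ _)).
by rewrite size_ann ltnS -card_distances_from //; exact: Xk.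
Qed.

Lemma dual_polyE X x y : on_sphere X -> x \in X -> y \in X ->
  (dual_poly (dots_from X x)).[dot x y] = (x == y)%:R.
Proof.
move=> XS xX yX; rewrite hornerZ; have [<-|xy] := eqVneq x y.
  rewrite (on_sphereP XS xX) mulVf // gt_eqF // ann1_gt0 // => a.
  exact: dots_from_lt1.
have /root_ann -> : dot x y \in dots_from X x by apply/dots_fromP; exists y.
by rewrite mulr0.
Qed.

End Distances.

Lemma weights_unique (R : realType) d k t (X : {fset 'rV[R]_d}) (w w' : X -> R) :
  on_sphere X -> locally_distance_set k X -> (k <= t)%N ->
  weighted_design t w -> weighted_design t w' -> w = w'.
Proof.
move=> XS Xk kt [_ _ Hw] [_ _ Hw']; apply/funext => x.
have sz (i : X) : (size (dual_poly (dots_from X (val i))) <= t.+1)%N.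
  by apply: leq_trans (size_dual_poly XS Xk (valP i)) _.
have del (i j : X) : (dual_poly (dots_from X (val i))).[dot (val i) (val j)] = (i == j)%:R.
  by rewrite dual_polyE //; exact: valP.
rewrite (design_weight (J := @sphere_avg R d) Hw sz del).
by rewrite (design_weight (J := @sphere_avg R d) Hw' sz del).
Qed.

Lemma weighted_designP (R : realType) d t (X : {fset 'rV[R]_d.+1}) (w : X -> R) :
  on_sphere X -> (forall x, 0 < w x) -> design (@sphere_avg R d.+1) t w val ->
  weighted_design t w.
Proof.
move=> XS w0 HD; split => //; split => //.
have [J JE HJ] := sphere_avg_mean R d.
have := HD 1; rewrite -JE (mean1 HJ) mpoly.msize1 => /(_ isT) ->.
by apply: eq_bigr => x _; rewrite mpoly.meval1 mulr1.
Qed.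

Section Converse.
Variables (R : realType) (d k : nat) (X : {fset 'rV[R]_d}).
Hypothesis XS : on_sphere X.

Lemma locally_distance_of_roots (Q : {poly R}) : (size Q <= k.+1)%N -> Q != 0 ->
  (forall x y, x \in X -> y \in X -> x != y -> Q.[dot x y] = 0) ->
  locally_distance_set k X /\ (#|` dots X| <= k)%N.
Proof.
move=> Qk Q0 QX; split => [x xX|].
  rewrite card_distances_from //; apply: (card_roots Qk Q0) => _ /dots_fromP[y [yX xy ->]].
  exact: QX.
by apply: (card_roots Qk Q0) => _ /dotsP[x [y [xX yX xy ->]]]; exact: QX.
Qed.

End Converse.

(** Substituting -t permutes the roots and changes the sign of each factor. *)
Lemma parity_ann (R : realType) (A : {fset R}) :
  (forall a, a \in A -> - a \in A) -> parity_poly #|` A| (ann A).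
Proof.
move=> AN.
have pA : perm_eq A [seq - a | a <- A].
  apply: uniq_perm; rewrite ?(map_inj_uniq oppr_inj) ?fset_uniq // => a.
  apply/idP/mapP => [aA|[b bA ->]]; last exact: AN.
  by exists (- a); rewrite ?opprK // AN.
have prodN (s : seq R) : (\prod_(a <- s) ('X - (- a)%:P)) \Po (- 'X) =
    (-1) ^+ size s *: \prod_(a <- s) ('X - a%:P).
  elim: s => [|a s IHs]; first by rewrite !big_nil rmorph1 expr0 scale1r.
  rewrite !big_cons rmorphM /= IHs comp_polyB comp_polyX comp_polyC exprS polyCN.
  by rewrite -!mul_polyC rmorphM /= polyCN polyC1; ring.
have annN : ann A \Po (- 'X) = (-1) ^+ #|` A| *: ann A.
  by rewrite -prodN /ann (perm_big _ pA) big_map.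
have coefN i : (ann A \Po (- 'X))`_i = (-1) ^+ i * (ann A)`_i.
  rewrite comp_polyE; under eq_bigr do rewrite exprNn -mul_polyC mulrA -(rmorph_sign polyC)
    -polyCM mul_polyC mulrC.
  rewrite -(poly_def _ (fun i => (-1) ^+ i * (ann A)`_i)) coef_poly; case: ltnP => // Ai.
  by rewrite nth_default // mulr0.
move=> i Ai; have := coefN i; rewrite annN coefZ => /(mulIf Ai).
rewrite -signr_odd -[RHS]signr_odd; case: (odd i); case: (odd _) => //= /eqP.
  by rewrite expr0 expr1 -addr_eq0 -[1 + 1]/(2%:R) pnatr_eq0.
by rewrite expr0 expr1 eq_sym -addr_eq0 -[1 + 1]/(2%:R) pnatr_eq0.
Qed.

(** * Tight designs of even degree *)

Section Even.
Variables (R : realType) (p n : nat).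
Local Notation d := p.+2.
Local Notation k := n.+1.

Lemma tight_size_evenE : tight_size_even d k = ('C(p.+1 + n.+1, n.+1) + 'C(p.+1 + n, n))%N.
Proof. by rewrite /tight_size_even !addSn !addnS !subSS !subn0. Qed.

Lemma tight_size_oddE : tight_size_odd d k = (2 * 'C(p.+1 + n, n))%N.
Proof. by rewrite /tight_size_odd !addSn !addnS !subSS !subn0. Qed.

(** The dual functions are the normalised annihilators of the inner products
    seen from each point. *)
Theorem even_design_of_distances (X : {fset 'rV[R]_d}) :
  on_sphere X -> locally_distance_set k X -> #|` X| = tight_size_even d k ->
  exists w : X -> R, tight_even_design k w.
Proof.
move=> XS Xk cX; have [J JE HJ] := sphere_avg_mean R p.+1.
have [|i|i j||i|w [w0 HD]] := @design_of_dual_even R p J HJ X val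
    (fun x : X => dual_poly (dots_from X (val x))) n.
- by move=> i; apply: on_sphereP XS _ (valP i).
- exact: size_dual_poly (valP i).
- by rewrite dual_polyE //; exact: valP.
- by rewrite -cardfE cX tight_size_evenE.
- rewrite lead_coefZ (monicP (ann_monic _)) mulr1 invr_gt0 ann1_gt0 // => a.
  by apply: dots_from_lt1; last exact: valP.
exists w; split => //; apply: weighted_designP => // f ft.
by rewrite -JE; exact: HD.
Qed.

(** If there were fewer than k distances, the square of (t - 1) times the
    annihilator of all inner products would have degree at most 2k and vanish on
    X. *)
Theorem distances_of_even_design (X : {fset 'rV[R]_d}) (w : X -> R) :
  tight_even_design k w -> locally_distance_set k X /\ distance_set k X.
Proof.
move=> [[XS [w0 w1] HD] cX]; have [J JE HJ] := sphere_avg_mean R p.+1.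
have {}HD : design J (2 * k) w val by move=> f ft; rewrite JE; exact: HD.
have ptS (i : X) : onS (val i) by exact: on_sphereP XS _ (valP i).
have cX' : #|{: X}| = ('C(p.+1 + n.+1, n.+1) + 'C(p.+1 + n, n))%N.
  by rewrite -cardfE cX tight_size_evenE.
have [Q [Qk Q1 QX]] := tight_even_kernel HJ ptS w0 w1 HD cX'.
have Q0 : Q != 0 by apply: contra_neq Q1 => ->; rewrite horner0.
have [|loc glob] := @locally_distance_of_roots R d k X XS Q Qk Q0.
  by move=> x y xX yX xy; apply: (QX [` xX] [` yX]); rewrite -(inj_eq val_inj).
split => //; apply/eqP; rewrite card_distances // eqn_leq glob leqNgt; apply/negP => lt_k.
pose q : {poly R} := (('X - 1%:P) * ann (dots X)) ^+ 2.
have mon : ('X - 1%:P) * ann (dots X) \is monic by rewrite monicMl ?ann_monic ?monicXsubC.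
have /card_gt0P[x _] : (0 < #|{: X}|)%N by rewrite cX' addn_gt0 bin_gt0 leq_addl.
have q0 : q = 0.
  apply: (design_nonneg_eq0 HJ HD (x := val x)) => //.
  - apply: (leq_trans (size_polyMleq _ _)); rewrite size_Mmonic ?polyXsubC_eq0 ?ann_monic //.
    by rewrite size_XsubC size_ann; lia.
  - by move=> s _; rewrite horner_exp sqr_ge0.
  - move=> y; rewrite horner_exp hornerM; have [->|xy] := eqVneq x y.
      by rewrite ptS !hornerE subrr mul0r expr0n.
    rewrite root_ann ?mulr0 ?expr0n //; apply/dotsP; exists (val x), (val y).
    by split => //; exact: valP.
by have := monic_neq0 (monic_exp 2 mon); rewrite -/q q0 eqxx.
Qed.

End Even.

(** * Tight designs of odd degree *)

Section Odd.
Variables (R : realType) (p n : nat).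
Local Notation d := p.+2.
Local Notation k := n.+1.

Lemma opp_in_dots_from (X : {fset 'rV[R]_d}) x : antipodal X -> on_sphere X -> x \in X ->
  -1 \in dots_from X x.
Proof.
move=> XN XS xX; have xS := on_sphereP XS xX.
apply/dots_fromP; exists (- x); split; first exact: XN.
  by rewrite eq_sym opp_neq.
by rewrite dotNr xS.
Qed.

(** The inner product -1 is left out of the annihilators, since only one point
    of each pair is used; the remaining ones are symmetric under negation, so
    the annihilator has a parity, which a factor t adjusts when needed. *)
Theorem odd_design_of_distances (X : {fset 'rV[R]_d}) :
  on_sphere X -> antipodal X -> locally_distance_set k X -> #|` X| = tight_size_odd d k ->
  exists w : X -> R, tight_odd_design k w.
Proof.
move=> XS XN Xk cX; have [J JE HJ] := sphere_avg_mean R p.+1.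
pose A x := dots_from X x `\ -1.
pose h x : {poly R} := (ann (A x)).[1]^-1 *:
  (if odd #|` A x| == odd n then ann (A x) else 'X * ann (A x)).
have AX x a : a \in A x -> a \in dots_from X x by rewrite inE => /andP[].
have A1 x : x \in X -> 0 < (ann (A x)).[1].
  by move=> xX; apply: ann1_gt0 => a /AX; apply: dots_from_lt1.
have cA x : x \in X -> (#|` A x| <= n)%N.
  move=> xX; have := Xk x xX; rewrite card_distances_from //.
  by rewrite (cardfsD1 (-1)) opp_in_dots_from.
have hpar x : x \in X -> parity_poly n (h x).
  move=> xX; have AN a : a \in A x -> - a \in A x.
    rewrite !in_fsetD1 => /andP[aN1 /dots_fromP[y [yX xy ay]]].
    have xS := on_sphereP XS xX; have yS := on_sphereP XS yX.
    rewrite eqr_opp ay dot_unit_neq1 //=; apply/dots_fromP; exists (- y).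
    split; [exact: XN| |by rewrite dotNr].
    by apply: contraNneq aN1 => e; rewrite ay e dotNl yS.
  have parA := parity_ann AN => i; rewrite coefZ mulf_eq0 negb_or => /andP[_].
  case: (eqVneq (odd #|` A x|) (odd n)) => [<-|par]; first exact: parA.
  rewrite coefXM; case: i => [|i] /=; first by rewrite eqxx.
  by move/parA => ->; move: par; case: (odd n); case: (odd _).
have [||||||||w [w0 HD]] := @design_of_dual_odd R p J HJ X h n.
- exact: on_sphereP.
- exact: XN.
- by rewrite cX tight_size_oddE.
- move=> x xX; apply: (leq_trans (size_scale_leq _ _)); have cAx := cA x xX.
  case: (eqVneq (odd #|` A x|) (odd n)) => [_|par]; first by rewrite size_ann.
  rewrite size_Mmonic ?polyX_eq0 ?ann_monic // size_polyX size_ann /=.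
  rewrite ltnS ltn_neqAle cAx andbT.
  by apply: contraNneq par => ->.
- exact: hpar.
- move=> x xX; rewrite hornerZ; case: ifP => _; rewrite ?hornerM ?hornerX ?mul1r mulVf //;
    by rewrite gt_eqF // A1.
- move=> x y xX yX xy xNy; rewrite hornerZ.
  have yA : dot x y \in A x.
    rewrite in_fsetD1; apply/andP; split; last by apply/dots_fromP; exists y.
    rewrite -eqr_oppLR -dotNr; apply: dot_unit_neq1 => //; first exact: on_sphereP XS _ xX.
    exact: on_sphereP XS _ (XN _ yX).
  by case: ifP => _; rewrite ?hornerM (root_ann yA) !mulr0.
- move=> x xX; rewrite lead_coefZ (_ : lead_coef _ = 1); first by rewrite mulr1 invr_gt0 A1.
  by apply/monicP; case: ifP => _; [|rewrite monicMl ?monicX //]; exact: ann_monic.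
exists w; split => //.
apply: weighted_designP => // f ft; rewrite -JE; apply: HD.
by apply: leq_trans ft _; lia.
Qed.

(** If there were fewer than k distances, (t + 1) ((t - 1) P(t))^2, with P the
    annihilator of the inner products other than -1, would have degree at most
    2k - 1, because -1 is one of the inner products, and vanish on X. *)
Theorem distances_of_odd_design (X : {fset 'rV[R]_d}) (w : X -> R) :
  tight_odd_design k w -> [/\ antipodal X, locally_distance_set k X & distance_set k X].
Proof.
move=> [[XS [w0 w1] HD] cX]; have [J JE HJ] := sphere_avg_mean R p.+1.
have {}HD : design J (2 * n).+1 w val.
  by move=> f ft; rewrite JE; apply: HD; apply: leq_trans ft _; lia.
have ptS (i : X) : onS (val i) by exact: on_sphereP XS _ (valP i).
have cX' : #|{: X}| = (2 * 'C(p.+1 + n, n))%N by rewrite -cardfE cX tight_size_oddE.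
have [XN [Q [Qk Q1 QX]]] := tight_odd_kernel HJ ptS w0 w1 HD cX'.
have {}XN : antipodal X.
  by move=> x xX; have [j /= <-] := XN [` xX]; exact: valP.
have Q0 : Q != 0 by apply: contra_neq Q1 => ->; rewrite horner0.
have [|loc glob] := @locally_distance_of_roots R d k X XS Q Qk Q0.
  by move=> x y xX yX xy; apply: (QX [` xX] [` yX]); rewrite -(inj_eq val_inj).
split => //; apply/eqP; rewrite card_distances // eqn_leq glob leqNgt; apply/negP => lt_k.
have /card_gt0P[x _] : (0 < #|{: X}|)%N by rewrite cX' muln_gt0 bin_gt0 leq_addl.
pose D := dots X `\ -1.
have cD : #|` dots X| = #|` D|.+1.
  rewrite (cardfsD1 (-1)) (_ : _ \in _) //.
  have /dots_fromP[y [yX xy e]] := opp_in_dots_from XN XS (valP x).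
  by apply/dotsP; exists (val x), y; split => //; exact: valP.
pose q : {poly R} := ('X + 1%:P) * (('X - 1%:P) * ann D) ^+ 2.
have mon : ('X - 1%:P) * ann D \is monic by rewrite monicMl ?ann_monic ?monicXsubC.
have q0 : q = 0.
  apply: (design_nonneg_eq0 HJ HD (x := val x)) => //.
  - have s2 : size ('X + 1%:P : {poly R}) = 2%N by rewrite size_XaddC.
    rewrite size_Mmonic ?monic_exp // -?size_poly_eq0 s2 //.
    have sz : (size (('X - 1%:P) * ann D)).-1 = (#|` D|).+1.
      by rewrite size_Mmonic ?polyXsubC_eq0 ?ann_monic // size_XsubC size_ann.
    have := size_exp (('X - 1%:P) * ann D) 2; rewrite sz.
    move: cD lt_k; move: (#|` D|) (#|` dots X|) => a b; move: (size _) => c; lia.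
  - move=> s /andP[s1 _]; rewrite hornerM horner_exp mulr_ge0 ?sqr_ge0 //.
    by rewrite !hornerE; lra.
  - move=> y; rewrite hornerM horner_exp hornerM; have [->|xy] := eqVneq x y.
      by rewrite ptS hornerXsubC subrr mul0r expr0n mulr0.
    have [->|xyN] := eqVneq (dot (val x) (val y)) (-1).
      by rewrite hornerD hornerX hornerC addNr mul0r.
    have /root_ann -> : dot (val x) (val y) \in D.
      rewrite in_fsetD1 xyN; apply/dotsP; exists (val x), (val y).
      by split => //; exact: valP.
    by rewrite mulr0 expr0n mulr0.
have /monic_neq0 : q \is monic by rewrite monicMr ?monic_exp ?monicXaddC.
by rewrite q0 eqxx.
Qed.

End Odd.

(** * Dimension one *)

Section DimensionOne.
Variable R : realType.
Implicit Types X : {fset 'rV[R]_1}.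

Lemma onS_dim1 (x y : 'rV[R]_1) : onS x -> onS y -> x != y -> y = - x.
Proof.
move=> /onS1[] -> /onS1[] ->; rewrite ?eqxx // => _; apply/rowP => i; rewrite !mxE ?opprK //.
Qed.

Lemma cardfs2 (T : choiceType) (A : {fset T}) : #|` A| = 2%N ->
  exists x y, x != y /\ A = [fset x; y].
Proof.
move=> cA; have /fset0Pn[x xA] : A != fset0 by rewrite -cardfs_gt0 cA.
have /eqP/cardfs1P[y yE] : #|` A `\ x| = 1%N by move: cA; rewrite (cardfsD1 x) xA => -[].
exists x, y; split; last by rewrite -(fsetD1K xA) yE.
have : y \in A `\ x by rewrite yE inE.
by rewrite in_fsetD1 eq_sym => /andP[].
Qed.

Lemma dim1_pair X : on_sphere X -> #|` X| = 2%N ->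
  antipodal X /\ exists2 x, x \in X & forall F : 'rV[R]_1 -> R,
    \sum_(y : X) F (val y) = F x + F (- x).
Proof.
move=> /on_sphereP XS /cardfs2[x [y [xy XE]]].
have yE : y = - x by apply: onS_dim1 xy; apply: XS; rewrite XE !inE eqxx ?orbT.
have {yE} XE : X = [fset x; - x] by rewrite XE yE.
split=> [z|]; first by rewrite XE !inE eqr_opp eqr_oppLR orbC.
exists x => [|F]; first by rewrite XE !inE eqxx.
rewrite -(big_seq_fsetE _ X xpredT F) XE big_fsetU1 ?big_seq_fset1 //.
rewrite inE eq_sym opp_neq //; apply: XS.
by rewrite XE !inE eqxx.
Qed.

Lemma dim1_distances X k : on_sphere X -> #|` X| = 2%N -> (0 < k)%N ->
  locally_distance_set k X /\ (k = 1%N -> distance_set k X).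
Proof.
move=> XS cX k0.
have Q0 : 'X + 1%:P != 0 :> {poly R} by rewrite -size_poly_eq0 size_XaddC.
have [|||loc glob] := @locally_distance_of_roots R 1 1 X XS ('X + 1%:P).
- by rewrite size_XaddC.
- exact: Q0.
- move=> x y xX yX xy; have xS := on_sphereP XS xX; have yS := on_sphereP XS yX.
  by rewrite (onS_dim1 xS yS xy) dotNr xS !hornerE addNr.
split=> [x xX|->]; first by apply: leq_trans k0; exact: loc.
apply/eqP; rewrite eqn_leq card_distances // glob cardfs_gt0.
have [x [y [xy XE]]] := cardfs2 cX; apply/fset0Pn; exists (dot x y).
by apply/dotsP; exists x, y; split; rewrite // XE !inE eqxx ?orbT.
Qed.

Lemma dim1_design X t : on_sphere X -> #|` X| = 2%N -> exists w : X -> R, weighted_design t w.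
Proof.
move=> XS cX; have [_ [x xX sumE]] := dim1_pair XS cX.
exists (fun=> 2^-1); apply: weighted_designP => // f _.
rewrite -mulr_sumr (sumE (fun y => mpoly.meval (y ord0) f)).
have SI (F : 'rV[R]_1 -> R) :
  sphere_integral F = F (const_mx 1) + F (const_mx (- 1)) by [].
have cN c : - const_mx c = const_mx (- c) :> 'rV[R]_1.
  by apply/matrixP => i j; rewrite !mxE.
rewrite /sphere_avg /sphere_area !SI -[1 + 1]/(2%:R); congr (_ * _).
by case: (onS1 (on_sphereP XS xX)) => ->; rewrite cN ?opprK // addrC.
Qed.

End DimensionOne.

Theorem theorem1p2 (R : realType) (d k : nat) (d_gt0 : (0 < d)%N)
    (k_gt0 : (0 < k)%N) :
  ((forall X : {fset 'rV[R]_d},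
      on_sphere X -> locally_distance_set k X ->
      #|` X| = tight_size_even d k ->
      exists! w : X -> R, tight_even_design k w) /\
   (forall (X : {fset 'rV[R]_d}) (w : X -> R),
      tight_even_design k w ->
      locally_distance_set k X /\
      ((1 < d)%N \/ k = 1%N -> distance_set k X)))
  /\
  ((forall X : {fset 'rV[R]_d},
      on_sphere X -> antipodal X -> locally_distance_set k X ->
      #|` X| = tight_size_odd d k ->
      exists! w : X -> R, tight_odd_design k w) /\
   (forall (X : {fset 'rV[R]_d}) (w : X -> R),
      tight_odd_design k w ->
      [/\ antipodal X,
          locally_distance_set k X &
          ((1 < d)%N \/ k = 1%N -> distance_set k X)])).
Proof.
have [n kE] : exists n, k = n.+1 by case: k k_gt0 => // n _; exists n.
have size_even1 : tight_size_even 1 k = 2%N.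
  by rewrite /tight_size_even kE !add1n !subSS !subn0 !binn.
have size_odd1 : tight_size_odd 1 k = 2%N.
  by rewrite /tight_size_odd kE !add1n !subSS !subn0 !binn.
have k_even : (k <= 2 * k)%N by lia.
have k_odd : (k <= 2 * k - 1)%N by lia.
split; split.
- move=> X XS Xk cX.
  have [w Hw] : exists w : X -> R, tight_even_design k w.
    case: d d_gt0 X XS Xk cX => // -[_|p _] X XS Xk cX.
      have [|w Hw] := @dim1_design R X (2 * k) XS; first by rewrite cX.
      by exists w.
    by move: Xk cX; rewrite kE; exact: even_design_of_distances.
  by exists w; split=> // w' [Hw' _]; case: Hw => Hw _; exact: weights_unique XS Xk k_even Hw Hw'.
- case: d d_gt0 => // -[_|p _] X w Hw.
    have [[XS _ _] cX] := Hw; rewrite size_even1 in cX.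
    have [loc glob] := dim1_distances XS cX k_gt0; split=> // -[//|]; exact: glob.
  by move: Hw; rewrite kE => /distances_of_even_design[].
- move=> X XS XN Xk cX.
  have [w Hw] : exists w : X -> R, tight_odd_design k w.
    case: d d_gt0 X XS XN Xk cX => // -[_|p _] X XS XN Xk cX.
      have [|w Hw] := @dim1_design R X (2 * k - 1) XS; first by rewrite cX.
      by exists w.
    by move: Xk cX; rewrite kE; exact: odd_design_of_distances.
  by exists w; split=> // w' [Hw' _]; case: Hw => Hw _; exact: weights_unique XS Xk k_odd Hw Hw'.
case: d d_gt0 => // -[_|p _] X w Hw.
  have [[XS _ _] cX] := Hw; rewrite size_odd1 in cX.
  have [loc glob] := dim1_distances XS cX k_gt0; split=> //; first by have [] := dim1_pair XS cX.
  by move=> [//|]; exact: glob.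
by move: Hw; rewrite kE => /distances_of_odd_design[].
Qed.
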